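(* Let $G=\mathbb{T}\times\mathbb{R}^n\times V\times H$ be a unimodular translation complete subgroup of $G_{aWH}$, with $V\subsetneq\widehat{\mathbb{R}^n}$. Then $G$ is not admissible for $L^2(\mathbb{R}^n)$, i.e. there is no $\psi\in L^2(\mathbb{R}^n)$ for which $V_\psi:L^2(\mathbb{R}^n)\to L^2(G)$ is a nonzero scalar multiple of an isometry.
   Context: The dual group $\widehat{\mathbb{R}^n}$ is identified with $\mathbb{R}^n$ (column vectors) by associating to $\xi$ the character $x\mapsto e^{2\pi i\langle x,\xi\rangle}$. The affine Weyl-Heisenberg group is $G_{aWH}=\mathbb{T}\times\mathbb{R}^n\times\widehat{\mathbb{R}^n}\times\mathrm{GL}(n,\mathbb{R})$ with the product topology and group law $(z_1,x_1,\xi_1,h_1)(z_2,x_2,\xi_2,h_2)=(z_1z_2e^{2\pi i\langle\xi_1,h_1x_2\rangle},\,x_1+h_1x_2,\,\xi_1+h_1^{-T}\xi_2,\,h_1h_2)$, where $h^{-T}=(h^{-1})^T$. Its quasi-regular representation on $L^2(\mathbb{R}^n)$ is $\pi(z,x,\xi,h)=zT_xM_\xi D_h$, where $T_xf(y)=f(y-x)$, $M_\xi f(y)=e^{2\pi i\langle y,\xi\rangle}f(y)$, $D_hf(y)=|\det h|^{-1/2}f(h^{-1}y)$. A translation complete subgroup is a subgroup $G=\mathbb{T}\times\mathbb{R}^n\times V\times H$, where $V\subset\widehat{\mathbb{R}^n}$ is a linear subspace, $H$ is a closed subgroup of $\mathrm{GL}(n,\mathbb{R})$, and $h^TV\subset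 V$ for all $h\in H$; $L^2(G)$ is taken with respect to Haar measure. The generalized wavelet transform is $V_\psi f(\mathbf{x})=\langle f,\pi(\mathbf{x})\psi\rangle$, $\mathbf{x}\in G$. *)

(* Defs.v *)
From HB Require Import structures.
From mathcomp Require Import all_boot all_order all_algebra.
From mathcomp Require Import complex ring.
From mathcomp Require Import all_classical all_reals all_analysis.
From mathcomp Require Import measurable_realfun.

Set Implicit Arguments.
Unset Strict Implicit.
Unset Printing Implicit Defensive.

Import Order.TTheory GRing.Theory Num.Theory numFieldNormedType.Exports.

Local Open Scope classical_set_scope.
Local Open Scope ring_scope.

Section Dot.
Variables (R : realType) (n : nat).
Implicit Types (x y : 'cV[R]_n) (h : 'M[R]_n).

Definition dotv x y : R := \sum_(i < n) x i 0 * y i 0.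

Lemma dotvE x y : dotv x y = (x^T *m y) 0 0.
Proof. by rewrite mxE; apply: eq_bigr => i _; rewrite mxE. Qed.

Lemma dotvDl x1 x2 y : dotv (x1 + x2) y = dotv x1 y + dotv x2 y.
Proof. by rewrite !dotvE linearD mulmxDl mxE. Qed.

Lemma dotvDr x y1 y2 : dotv x (y1 + y2) = dotv x y1 + dotv x y2.
Proof. by rewrite !dotvE mulmxDr mxE. Qed.

Lemma dotvNr x y : dotv x (- y) = - dotv x y.
Proof. by rewrite !dotvE mulmxN mxE. Qed.

Lemma dotvNl x y : dotv (- x) y = - dotv x y.
Proof. by rewrite !dotvE linearN mulNmx mxE. Qed.

Lemma dotv0l y : dotv 0 y = 0.
Proof. by rewrite dotvE trmx0 mul0mx mxE. Qed.

Lemma dotv0r x : dotv x 0 = 0.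
Proof. by rewrite dotvE mulmx0 mxE. Qed.

Lemma dotvM h x y : dotv (h *m x) y = dotv x (h^T *m y).
Proof. by rewrite !dotvE trmx_mul mulmxA. Qed.
End Dot.

Section Circle.
Variable R : realType.

Definition circle := {z : R[i] | `|z| == 1}.

HB.instance Definition _ := [isSub of circle for sval].
HB.instance Definition _ := [Choice of circle by <:].

(* The topology of C is that of R^2, via real and imaginary parts. *)
Definition circle_coord (z : circle) : R * R :=
  (complex.Re (\val z), complex.Im (\val z)).

HB.instance Definition _ := Topological.copy circle (initial_topology circle_coord).

Lemma circle_norm (z : circle) : `|\val z| = 1. Proof. exact/eqP/(valP z). Qed.

Lemma circle_neq0 (z : circle) : \val z != 0.
Proof. by rewrite -normr_eq0 circle_norm oner_eq0. Qed.

Lemma circle1_subproof : `|1 : R[i]| == 1. Proof. by rewrite normr1. Qed.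
Lemma circleM_subproof (z w : circle) : `|\val z * \val w| == 1.
Proof. by rewrite normrM !circle_norm mulr1. Qed.
Lemma circleV_subproof (z : circle) : `|(\val z)^-1| == 1.
Proof. by rewrite normfV circle_norm invr1. Qed.

Definition circle_one : circle := exist _ 1 circle1_subproof.
Definition circle_mul (z w : circle) : circle := 
  exist _ (\val z * \val w) (circleM_subproof z w).
Definition circle_inv (z : circle) : circle := exist _ (\val z)^-1 (circleV_subproof z).

Lemma circle_mulA : associative circle_mul.
Proof. by move=> x y z; apply: val_inj; rewrite /= mulrA. Qed.
Lemma circle_mul1 : left_id circle_one circle_mul.
Proof. by move=> x; apply: val_inj; rewrite /= mul1r. Qed.
Lemma circle_mulC : commutative circle_mul.
Proof. by move=> x y; apply: val_inj; rewrite /= mulrC. Qed.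
Lemma circle_1mul : right_id circle_one circle_mul.
Proof. by move=> x; rewrite circle_mulC circle_mul1. Qed.
Lemma circle_mulV : left_inverse circle_one circle_inv circle_mul.
Proof. by move=> x; apply: val_inj; rewrite /= mulVf// circle_neq0. Qed.
Lemma circle_Vmul : right_inverse circle_one circle_inv circle_mul.
Proof. by move=> x; rewrite circle_mulC circle_mulV. Qed.

HB.instance Definition _ := isGroup.Build circle
  circle_mulA circle_mul1 circle_1mul circle_mulV circle_Vmul.
HB.instance Definition _ := isPointed.Build circle circle_one.

Lemma e2pi_subproof (t : R) :
  `|cos (2 * pi * t) +i* sin (2 * pi * t)|%C == 1 :> R[i].
Proof. by rewrite normc_def /= cos2Dsin2 sqrtr1. Qed.

Definition e2pi (t : R) : circle := 
  exist _ (cos (2 * pi * t) +i* sin (2 * pi * t))%C (e2pi_subproof t).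

Lemma e2piD s t : (e2pi (s + t) = e2pi s * e2pi t)%g.
Proof.
apply: val_inj => /=; rewrite mulrDr cosD sinD.
by congr Complex; rewrite addrC.
Qed.

Lemma e2pi0 : e2pi 0 = 1%g.
Proof. by apply: val_inj => /=; rewrite mulr0 cos0 sin0. Qed.

End Circle.

Section GL.
Variables (R : realType) (n : nat).

(* Unlike mathcomp's ['GL_n[R]], this allows an infinite field and n = 0. *)
Definition GL := {h : 'M[R]_n | h \in unitmx}.

HB.instance Definition _ := [isSub of GL for sval].
HB.instance Definition _ := [Choice of GL by <:].
HB.instance Definition _ :=
  Topological.copy GL (initial_topology (\val : GL -> 'M[R]_n)).

Lemma GL1_subproof : (1%:M : 'M[R]_n) \in unitmx. Proof. exact: unitmx1. Qed.
Lemma GLM_subproof (g h : GL) : \val g *m \val h \in unitmx.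
Proof. by rewrite unitmx_mul (valP g) (valP h). Qed.
Lemma GLV_subproof (g : GL) : invmx (\val g) \in unitmx.
Proof. by rewrite unitmx_inv (valP g). Qed.

Definition GL_one : GL := exist _ 1%:M GL1_subproof.
Definition GL_mul (g h : GL) : GL := 
  exist _ (\val g *m \val h) (GLM_subproof g h).
Definition GL_inv (g : GL) : GL := exist _ (invmx (\val g)) (GLV_subproof g).

Lemma GL_mulA : associative GL_mul.
Proof. by move=> x y z; apply: val_inj; rewrite /= mulmxA. Qed.
Lemma GL_mul1 : left_id GL_one GL_mul.
Proof. by move=> x; apply: val_inj; rewrite /= mul1mx. Qed.
Lemma GL_1mul : right_id GL_one GL_mul.
Proof. by move=> x; apply: val_inj; rewrite /= mulmx1. Qed.
Lemma GL_mulV : left_inverse GL_one GL_inv GL_mul.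
Proof. by move=> x; apply: val_inj; rewrite /= mulVmx// (valP x). Qed.
Lemma GL_Vmul : right_inverse GL_one GL_inv GL_mul.
Proof. by move=> x; apply: val_inj; rewrite /= mulmxV// (valP x). Qed.

HB.instance Definition _ := isGroup.Build GL
  GL_mulA GL_mul1 GL_1mul GL_mulV GL_Vmul.
HB.instance Definition _ := isPointed.Build GL GL_one.

End GL.

Section Continuity.
Variable R : realType.

Lemma continuous_mx (X : topologicalType) m n (f : X -> 'M[R]_(m, n)) :
  (forall i j, continuous (fun x => f x i j)) -> continuous f.
Proof.
move=> cf x A /= [P Px PA].
apply: (@filterS _ _ _ (fun y => forall i j, P i j (f y i j))).
  by move=> y Py; exact: PA.
apply: filter_forall => i; apply: filter_forall => j.
exact: (cf i j x _ (Px i j)).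
Qed.

Lemma entry_continuous m n (i : 'I_m) (j : 'I_n) :
  continuous (fun A : 'M[R]_(m, n) => A i j).
Proof. exact: coord_continuous. Qed.

Lemma continuous_comp_fun (X Y Z : topologicalType) (f : X -> Y) (g : Y -> Z) :
  continuous f -> continuous g -> continuous (fun x => g (f x)).
Proof. by move=> cf cg x; apply: continuous_comp; [exact: cf|exact: cg]. Qed.

Lemma continuous_entry (X : topologicalType) m n (f : X -> 'M[R]_(m, n)) i j :
  continuous f -> continuous (fun x => f x i j).
Proof. by move=> cf; exact: (continuous_comp_fun cf (@entry_continuous _ _ i j)). Qed.

Lemma continuous_addr (X : topologicalType) (f g : X -> R) :
  continuous f -> continuous g -> continuous (fun x => f x + g x).
Proof. by move=> cf cg x; apply: cvgD; [exact: cf|exact: cg]. Qed.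

Lemma continuous_mulr (X : topologicalType) (f g : X -> R) :
  continuous f -> continuous g -> continuous (fun x => f x * g x).
Proof. by move=> cf cg x; apply: cvgM; [exact: cf|exact: cg]. Qed.

Lemma continuous_oppr (X : topologicalType) (f : X -> R) :
  continuous f -> continuous (fun x => - f x).
Proof. by move=> cf x; apply: cvgN; exact: cf. Qed.

Lemma continuous_sumr (X : topologicalType) (I : finType) (F : I -> X -> R) :
  (forall i, continuous (F i)) -> continuous (fun x => \sum_i F i x).
Proof.
move=> cF; apply: continuous_big => [|i _]; last exact: cF.
exact: add_continuous.
Qed.

Lemma continuous_prodr (X : topologicalType) (I : finType) (F : I -> X -> R) :
  (forall i, continuous (F i)) -> continuous (fun x => \prod_i F i x).
Proof.
move=> cF; apply: continuous_big => [|i _]; last exact: cF.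
exact: mul_continuous.
Qed.

Lemma continuous_det (X : topologicalType) n (f : X -> 'M[R]_n) :
  (forall i j, continuous (fun x => f x i j)) -> continuous (fun x => \det (f x)).
Proof.
move=> cf; apply: continuous_sumr => s; apply: continuous_mulr.
  exact: cst_continuous.
by apply: continuous_prodr => i; exact: cf.
Qed.

Lemma continuous_mulmx (X : topologicalType) m n p
    (f : X -> 'M[R]_(m, n)) (g : X -> 'M[R]_(n, p)) :
  continuous f -> continuous g -> continuous (fun x => f x *m g x).
Proof.
move=> cf cg; apply: continuous_mx => i j.
under eq_fun do rewrite mxE.
apply: continuous_sumr => k; apply: continuous_mulr.
  exact: continuous_entry.
exact: continuous_entry.
Qed.

Lemma continuous_trmx (X : topologicalType) m n (f : X -> 'M[R]_(m, n)) :
  continuous f -> continuous (fun x => (f x)^T).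
Proof.
move=> cf; apply: continuous_mx => i j; under eq_fun do rewrite mxE.
exact: continuous_entry.
Qed.

Lemma continuous_addmx (X : topologicalType) m n (f g : X -> 'M[R]_(m, n)) :
  continuous f -> continuous g -> continuous (fun x => f x + g x).
Proof.
move=> cf cg; apply: continuous_mx => i j.
under eq_fun do rewrite mxE.
apply: continuous_addr.
  exact: continuous_entry.
exact: continuous_entry.
Qed.

Lemma continuous_oppmx (X : topologicalType) m n (f : X -> 'M[R]_(m, n)) :
  continuous f -> continuous (fun x => - f x).
Proof.
move=> cf; apply: continuous_mx => i j.
under eq_fun do rewrite mxE.
apply: continuous_oppr.
exact: continuous_entry.
Qed.

Lemma continuous_invmx (X : topologicalType) n (f : X -> 'M[R]_n) :
  (forall x, f x \in unitmx) ->
  continuous f -> continuous (fun x => invmx (f x)).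
Proof.
move=> fu cf; apply: continuous_mx => i j.
have cfe i' j' : continuous (fun x => f x i' j').
  exact: continuous_entry.
rewrite (_ : (fun x => _) = (fun x => (\det (f x))^-1 * cofactor (f x) j i)).
  apply: continuous_mulr.
    move=> x; apply: cvgV; last exact: continuous_det.
    by have := fu x; rewrite unitmxE unitfE.
  apply: continuous_mulr; first exact: cst_continuous.
  apply: continuous_det => a b.
  by under eq_fun do rewrite !mxE; exact: cfe.
by apply/funext => x; rewrite /invmx fu !mxE.
Qed.

Lemma continuous_dotv (X : topologicalType) n (f g : X -> 'cV[R]_n) :
  continuous f -> continuous g -> continuous (fun x => dotv (f x) (g x)).
Proof.
move=> cf cg; apply: continuous_sumr => i.
apply: continuous_mulr.
  exact: continuous_entry.
exact: continuous_entry.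
Qed.

Lemma continuous_pairing (X Y Z : topologicalType) (f : X -> Y) (g : X -> Z) :
  continuous f -> continuous g -> continuous (fun x => (f x, g x)).
Proof. by move=> cf cg x; apply: cvg_pair; [exact: cf|exact: cg]. Qed.


Lemma fst_is_continuous (X Y : topologicalType) : continuous (@fst X Y).
Proof. by move=> x; exact: cvg_fst. Qed.

Lemma snd_is_continuous (X Y : topologicalType) : continuous (@snd X Y).
Proof. by move=> x; exact: cvg_snd. Qed.

Lemma circle_re_continuous : continuous (fun z : circle R => complex.Re (\val z)).
Proof.
have := @initial_continuous (circle R) _ (@circle_coord R).
by move=> /continuous_comp_fun /(_ (@fst_is_continuous _ _)).
Qed.

Lemma circle_im_continuous : continuous (fun z : circle R => complex.Im (\val z)).
Proof.
have := @initial_continuous (circle R) _ (@circle_coord R).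
by move=> /continuous_comp_fun /(_ (@snd_is_continuous _ _)).
Qed.

Lemma to_circle_continuous (X : topologicalType) (f : X -> circle R) :
  continuous (fun x => complex.Re (\val (f x))) ->
  continuous (fun x => complex.Im (\val (f x))) -> continuous f.
Proof.
move=> cre cim; apply: (@continuous_comp_initial _ _ _ (@circle_coord R) f).
exact: continuous_pairing.
Qed.

Lemma continuous_circle_mul (X : topologicalType) (f g : X -> circle R) :
  continuous f -> continuous g -> continuous (fun x => (f x * g x)%g).
Proof.
move=> cf cg.
have fr := continuous_comp_fun cf circle_re_continuous.
have fi := continuous_comp_fun cf circle_im_continuous.
have gr := continuous_comp_fun cg circle_re_continuous.
have gi := continuous_comp_fun cg circle_im_continuous.
apply: to_circle_continuous.
  rewrite (_ : (fun x => _) = (fun x =>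
    complex.Re (\val (f x)) * complex.Re (\val (g x)) +
    - (complex.Im (\val (f x)) * complex.Im (\val (g x))))); last first.
    by apply/funext => x /=; case: (\val (f x)) => a b; case: (\val (g x)).
  by apply: continuous_addr; [|apply: continuous_oppr]; exact: continuous_mulr.
rewrite (_ : (fun x => _) = (fun x =>
  complex.Re (\val (f x)) * complex.Im (\val (g x)) +
  complex.Im (\val (f x)) * complex.Re (\val (g x)))); last first.
  by apply/funext => x /=; case: (\val (f x)) => a b; case: (\val (g x)).
by apply: continuous_addr; exact: continuous_mulr.
Qed.

Lemma continuous_circle_inv (X : topologicalType) (f : X -> circle R) :
  continuous f -> continuous (fun x => (f x)^-1%g).
Proof.
move=> cf.
have fr := continuous_comp_fun cf circle_re_continuous.
have fi := continuous_comp_fun cf circle_im_continuous.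
have E (z : circle R) : \val (z^-1)%g = ((\val z)^*)%C.
  have z0 := circle_neq0 z.
  apply: (mulfI z0); rewrite /= divff// -sqr_normc circle_norm expr1n.
  by [].
apply: to_circle_continuous.
  by under eq_fun do rewrite E; move: fr; rewrite (_ : (fun x => complex.Re (\val (f x))) =
    (fun x => complex.Re (\val (f x))^*%C))//; apply/funext => x; case: (\val (f x)).
rewrite (_ : (fun x => _) = (fun x => - complex.Im (\val (f x)))).
  exact: continuous_oppr.
by apply/funext => x; rewrite E; case: (\val (f x)).
Qed.

Lemma e2pi_continuous : continuous (@e2pi R).
Proof.
have c2 : continuous (fun t : R => 2 * pi * t).
  by apply: continuous_mulr; [exact: cst_continuous|move=> x; exact: cvg_id].
apply: to_circle_continuous => /=.
  exact: (continuous_comp_fun c2 (@continuous_cos R)).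
exact: (continuous_comp_fun c2 (@continuous_sin R)).
Qed.

Lemma GL_val_continuous n : continuous (fun h : GL R n => \val h).
Proof. exact: (@initial_continuous (GL R n) _ (\val : GL R n -> 'M[R]_n)). Qed.

Lemma to_GL_continuous n (X : topologicalType) (f : X -> GL R n) :
  continuous (fun x => \val (f x)) -> continuous f.
Proof.
exact: (@continuous_comp_initial _ _ _ (\val : GL R n -> 'M[R]_n) f).
Qed.

End Continuity.

HB.mixin Record isTopologicalGroup G of Topological G & Group G := {
  mulg_continuous : continuous (fun p : G * G => (p.1 * p.2)%g) ;
  invg_continuous : continuous (fun g : G => (g^-1)%g)
}.

#[short(type="topologicalGroupType")]
HB.structure Definition TopologicalGroup :=
  {G of PointedTopological G & Group G & isTopologicalGroup G}.

Section AffineWeylHeisenberg.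
Variables (R : realType) (n : nat).

Definition aWH : Type := (circle R * 'cV[R]_n * 'cV[R]_n * GL R n)%type.

HB.instance Definition _ := Choice.copy aWH (circle R * 'cV[R]_n * 'cV[R]_n * GL R n)%type.
HB.instance Definition _ :=
  Topological.copy aWH (circle R * 'cV[R]_n * 'cV[R]_n * GL R n)%type.

Implicit Types g : aWH.

Definition aWH_z g : circle R := g.1.1.1.
Definition aWH_x g : 'cV[R]_n := g.1.1.2.
Definition aWH_xi g : 'cV[R]_n := g.1.2.
Definition aWH_h g : GL R n := g.2.

Definition aWH_mul g1 g2 : aWH :=
  let: (z1, x1, xi1, h1) := g1 in
  let: (z2, x2, xi2, h2) := g2 in
  ((z1 * z2 * e2pi (dotv xi1 (\val h1 *m x2)))%g,
   x1 + \val h1 *m x2,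
   xi1 + (invmx (\val h1))^T *m xi2,
   (h1 * h2)%g).

Definition aWH_one : aWH := (1%g, 0, 0, 1%g).

Definition aWH_inv g : aWH :=
  let: (z, x, xi, h) := g in
  ((z^-1 * e2pi (dotv xi x))%g, - (invmx (\val h) *m x), - ((\val h)^T *m xi),
   (h^-1)%g).

Lemma circle_mulgC (z w : circle R) : (z * w = w * z)%g.
Proof. exact: circle_mulC. Qed.

Lemma aWH_mulA : associative aWH_mul.
Proof.
move=> [[[z1 x1] xi1] h1] [[[z2 x2] xi2] h2] [[[z3 x3] xi3] h3] /=.
congr (_, _, _, _).
- rewrite mulmxDr dotvDr dotvDl !e2piD.
  rewrite [dotv (_^T *m _) _]dotvM trmxK !mulmxA mulVmx ?(valP h1)// mul1mx.
  move: (e2pi _) (e2pi _) (e2pi _) => a b c.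
  by apply: val_inj => /=; ring.
- by rewrite mulmxDr addrA mulmxA.
- rewrite mulmxDr addrA mulmxA -trmx_mul; congr (_ + _^T *m _).
  symmetry; apply: (can_inj (mulmxK (GLM_subproof h1 h2))).
  rewrite mulVmx ?GLM_subproof// mulmxA -(mulmxA _ (invmx (\val h1))).
  by rewrite mulVmx ?(valP h1)// mulmx1 mulVmx// (valP h2).
- by rewrite mulgA.
Qed.

Lemma aWH_mul1 : left_id aWH_one aWH_mul.
Proof.
move=> [[[z x] xi] h] /=; rewrite dotv0l e2pi0 mulg1 !mul1g !add0r mul1mx.
by rewrite invmx1 trmx1 mul1mx.
Qed.

Lemma aWH_1mul : right_id aWH_one aWH_mul.
Proof.
move=> [[[z x] xi] h] /=.
by rewrite !mulmx0 dotv0r e2pi0 !mulg1 !addr0.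
Qed.

Lemma aWH_Vmul : right_inverse aWH_one aWH_inv aWH_mul.
Proof.
move=> [[[z x] xi] h] /=; congr (_, _, _, _).
- rewrite mulmxN mulmxA mulmxV ?(valP h)// mul1mx dotvNr -!mulgA -e2piD.
  by rewrite subrr e2pi0 mulg1 mulgV.
- by rewrite mulmxN mulmxA mulmxV ?(valP h)// mul1mx subrr.
- by rewrite mulmxN mulmxA -trmx_mul mulmxV ?(valP h)// trmx1 mul1mx subrr.
- by rewrite mulgV.
Qed.

Lemma aWH_mulV : left_inverse aWH_one aWH_inv aWH_mul.
Proof.
move=> [[[z x] xi] h] /=; congr (_, _, _, _).
- rewrite dotvNl dotvM trmxK mulmxA mulmxV ?(valP h)// mul1mx.
  rewrite -(mulgA z^-1%g) (circle_mulgC _ z) mulgA mulVg mul1g -e2piD.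
  by rewrite subrr e2pi0.
- by rewrite addrC subrr.
- by rewrite invmxK addrC subrr.
- by rewrite mulVg.
Qed.

HB.instance Definition _ := isGroup.Build aWH
  aWH_mulA aWH_mul1 aWH_1mul aWH_mulV aWH_Vmul.
HB.instance Definition _ := isPointed.Build aWH aWH_one.

End AffineWeylHeisenberg.

Section AffineWeylHeisenbergTopology.
Variables (R : realType) (n : nat).
Local Notation aWH := (aWH R n).

Lemma aWH_z_continuous : continuous (@aWH_z R n).
Proof.
exact: (continuous_comp_fun (continuous_comp_fun (@fst_is_continuous _ _)
  (@fst_is_continuous _ _)) (@fst_is_continuous _ _)).
Qed.

Lemma aWH_x_continuous : continuous (@aWH_x R n).
Proof.
exact: (continuous_comp_fun (continuous_comp_fun (@fst_is_continuous _ _)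
  (@fst_is_continuous _ _)) (@snd_is_continuous _ _)).
Qed.

Lemma aWH_xi_continuous : continuous (@aWH_xi R n).
Proof.
exact: (continuous_comp_fun (@fst_is_continuous _ _) (@snd_is_continuous _ _)).
Qed.

Lemma aWH_h_continuous : continuous (@aWH_h R n).
Proof. exact: snd_is_continuous. Qed.

Lemma to_aWH_continuous (X : topologicalType) (f : X -> aWH) :
  continuous (fun x => aWH_z (f x)) -> continuous (fun x => aWH_x (f x)) ->
  continuous (fun x => aWH_xi (f x)) -> continuous (fun x => aWH_h (f x)) ->
  continuous f.
Proof.
move=> cz cx cxi ch.
have := continuous_pairing (continuous_pairing (continuous_pairing cz cx) cxi) ch.
rewrite (_ : (fun x => _) = f)//.
by apply/funext => x /=; case: (f x) => [[[]]].
Qed.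

Lemma aWH_mulg_continuous :
  continuous (fun p : aWH * aWH => (p.1 * p.2)%g).
Proof.
have c1 := @fst_is_continuous aWH aWH.
have c2 := @snd_is_continuous aWH aWH.
have h1 := continuous_comp_fun (continuous_comp_fun c1 aWH_h_continuous)
  (@GL_val_continuous R n).
have h2 := continuous_comp_fun (continuous_comp_fun c2 aWH_h_continuous)
  (@GL_val_continuous R n).
have x1 := continuous_comp_fun c1 aWH_x_continuous.
have x2 := continuous_comp_fun c2 aWH_x_continuous.
have xi1 := continuous_comp_fun c1 aWH_xi_continuous.
have xi2 := continuous_comp_fun c2 aWH_xi_continuous.
have z1 := continuous_comp_fun c1 aWH_z_continuous.
have z2 := continuous_comp_fun c2 aWH_z_continuous.
have iu (p : aWH * aWH) : \val (aWH_h p.1) \in unitmx := valP _.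
rewrite (_ : (fun p : aWH * aWH => _) = (fun p : aWH * aWH =>
  ((aWH_z p.1 * aWH_z p.2 *
      e2pi (dotv (aWH_xi p.1) (\val (aWH_h p.1) *m aWH_x p.2)))%g,
   aWH_x p.1 + \val (aWH_h p.1) *m aWH_x p.2,
   aWH_xi p.1 + (invmx (\val (aWH_h p.1)))^T *m aWH_xi p.2,
   (aWH_h p.1 * aWH_h p.2)%g) : aWH)); last first.
  by apply/funext => -[[[[? ?] ?] ?] [[[? ?] ?] ?]].
have hx := continuous_mulmx h1 x2.
apply: to_aWH_continuous.
- apply: continuous_circle_mul; first exact: continuous_circle_mul.
  exact: (continuous_comp_fun (continuous_dotv xi1 hx) (@e2pi_continuous R)).
- exact: continuous_addmx.
- apply: continuous_addmx => //; apply: continuous_mulmx => //.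
  by apply: continuous_trmx; exact: continuous_invmx.
- by apply: to_GL_continuous; exact: continuous_mulmx.
Qed.

Lemma aWH_invg_continuous : continuous (fun g : aWH => (g^-1)%g).
Proof.
have h := continuous_comp_fun aWH_h_continuous (@GL_val_continuous R n).
have x := aWH_x_continuous.
have xi := aWH_xi_continuous.
have z := aWH_z_continuous.
have iu (p : aWH) : \val (aWH_h p) \in unitmx := valP _.
rewrite (_ : (fun g : aWH => _) = (fun g : aWH =>
  (((aWH_z g)^-1 * e2pi (dotv (aWH_xi g) (aWH_x g)))%g,
   - (invmx (\val (aWH_h g)) *m aWH_x g),
   - ((\val (aWH_h g))^T *m aWH_xi g),
   ((aWH_h g)^-1)%g) : aWH)); last by apply/funext => -[[[]]].
apply: to_aWH_continuous.
- apply: continuous_circle_mul; first exact: continuous_circle_inv.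
  exact: (continuous_comp_fun (continuous_dotv xi x) (@e2pi_continuous R)).
- by apply: continuous_oppmx; apply: continuous_mulmx => //;
    exact: continuous_invmx.
- by apply: continuous_oppmx; apply: continuous_mulmx => //;
    exact: continuous_trmx.
- by apply: to_GL_continuous; exact: continuous_invmx.
Qed.

HB.instance Definition _ := isTopologicalGroup.Build aWH
  aWH_mulg_continuous aWH_invg_continuous.

End AffineWeylHeisenbergTopology.

Section TranslationComplete.
Variables (R : realType) (n : nat).

Record tcSubgroup := TcSubgroup {
  tcV : {vspace 'cV[R]_n} ;
  tcH : set (GL R n) ;
  tcH_closed : closed tcH ;
  tcH1 : tcH 1%g ;
  tcHM : forall g h, tcH g -> tcH h -> tcH (g * h)%g ;
  tcHV : forall g, tcH g -> tcH g^-1%g ;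
  tcV_stable : forall h v, tcH h -> v \in tcV -> (\val h)^T *m v \in tcV
}.

Variable G : tcSubgroup.

Definition tcSet : set (aWH R n) :=
  [set g | aWH_xi g \in tcV G /\ tcH G (aWH_h g)].

Definition tcType := {g : aWH R n | g \in tcSet}.

HB.instance Definition _ := [isSub of tcType for sval].
HB.instance Definition _ := [Choice of tcType by <:].
HB.instance Definition _ :=
  Topological.copy tcType (initial_topology (\val : tcType -> aWH R n)).

Lemma tcSet_group_closed : group_closed (fun g => g \in tcSet).
Proof.
split=> [|[[[z1 x1] xi1] h1] [[[z2 x2] xi2] h2] /set_mem[/= V1 H1]
    /set_mem[/= V2 H2]]; apply/mem_set.
  by split; [exact: mem0v|exact: tcH1].
split; last by apply: tcHM => //; exact: tcHV.
apply: memvD => //; rewrite mulmxN memvN.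
by apply: (tcV_stable (h := h1^-1%g)); [exact: tcHV|exact: tcV_stable].
Qed.

HB.instance Definition _ := SubChoice_isSubGroup.Build (aWH R n)
  (fun g => g \in tcSet) tcType tcSet_group_closed.
HB.instance Definition _ := isPointed.Build tcType 1%g.

Lemma tc_mulg_continuous :
  continuous (fun p : tcType * tcType => (p.1 * p.2)%g).
Proof.
have cv : continuous (\val : tcType -> aWH R n).
  exact: (@initial_continuous tcType _ (\val : tcType -> aWH R n)).
apply: (@continuous_comp_initial _ _ _ (\val : tcType -> aWH R n)).
have := continuous_comp_fun (continuous_pairing
  (continuous_comp_fun (@fst_is_continuous tcType tcType) cv)
  (continuous_comp_fun (@snd_is_continuous tcType tcType) cv))
  (@mulg_continuous (aWH R n)).
by [].
Qed.

Lemma tc_invg_continuous : continuous (fun g : tcType => (g^-1)%g).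
Proof.
have cv : continuous (\val : tcType -> aWH R n).
  exact: (@initial_continuous tcType _ (\val : tcType -> aWH R n)).
apply: (@continuous_comp_initial _ _ _ (\val : tcType -> aWH R n)).
exact: (continuous_comp_fun cv (@invg_continuous (aWH R n))).
Qed.

HB.instance Definition _ := isTopologicalGroup.Build tcType
  tc_mulg_continuous tc_invg_continuous.

End TranslationComplete.

Notation borel T := (g_sigma_algebraType (@open T)).

Section LebesgueTuple.
Variable R : realType.

Definition tuple_cons n (p : (R * n.-tuple R)%type) : n.+1.-tuple R :=
  [tuple of p.1 :: p.2].

Definition tuple_uncons n (t : n.+1.-tuple R) : (R * n.-tuple R)%type :=
  (thead t, [tuple of behead t]).

Lemma tuple_consK n : cancel (@tuple_cons n) (@tuple_uncons n).
Proof. by move=> [x t]; congr pair; apply: val_inj. Qed.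

Lemma measurable_tuple_cons n : measurable_fun setT (@tuple_cons n).
Proof. exact: measurable_cons. Qed.

Lemma measurable_tuple_uncons n : measurable_fun setT (@tuple_uncons n).
Proof.
apply/measurable_fun_pair; first exact: measurable_tnth.
exact: measurable_behead.
Qed.

Section Cons.
Variables (n : nat) (m : {sigma_finite_measure set (n.-tuple R) -> \bar R}).

Definition measure_cons : set (n.+1.-tuple R) -> \bar R :=
  pushforward (@lebesgue_measure R \x m)%E (@tuple_cons n).

HB.instance Definition _ := Measure.copy measure_cons
  (measure_function_pushforward__canonical__measure_function_Measure
    (@lebesgue_measure R \x m)%E (@measurable_tuple_cons n)).

Lemma measure_cons_sigma_finite : sigma_finite setT measure_cons.
Proof.
have /sigma_finiteP[F [FT ndF Foo]] :
  sigma_finite setT (@lebesgue_measure R) by exact: sigma_finiteT.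
have /sigma_finiteP[G [GT ndG Goo]] := sigma_finiteT m.
exists (fun k => @tuple_uncons n @^-1` (F k `*` G k)).
  rewrite -preimage_bigcup -[LHS](preimage_setT (@tuple_uncons n)).
  congr (_ @^-1` _); rewrite -setXTT FT GT predeqE => -[x y]; split.
    move=> [/= [i _ Fx] [k _ Gy]]; exists (maxn i k) => //; split => /=.
      by move: x Fx; exact/subsetPset/ndF/leq_maxl.
    by move: y Gy; exact/subsetPset/ndG/leq_maxr.
  by move=> [k _ []/= ? ?]; split; exists k.
move=> k; have [mF Fk] := Foo k; have [mG Gk] := Goo k; split.
  rewrite -[X in measurable X]setTI; apply: measurable_tuple_uncons => //.
  exact: measurableX.
rewrite /measure_cons /pushforward -comp_preimage.
rewrite (_ : _ \o _ = id); last by apply/funext => p; exact: tuple_consK.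
rewrite product_measure1E//.
by rewrite lte_mul_pinfty// ge0_fin_numE.
Qed.

HB.instance Definition _ :=
  Measure_isSigmaFinite.Build _ _ _ measure_cons measure_cons_sigma_finite.

End Cons.

Fixpoint lebesgue_tuple n : {sigma_finite_measure set (n.-tuple R) -> \bar R} :=
  match n with
  | 0 => \d_ [tuple]
  | n'.+1 => measure_cons (lebesgue_tuple n')
  end.

Lemma lebesgue_tuple_prod n (A : 'I_n -> set R) :
  (forall i, measurable (A i)) ->
  lebesgue_tuple n [set t | forall i, A i (tnth t i)] =
  (\prod_(i < n) @lebesgue_measure R (A i))%E.
Proof.
elim: n A => [|n IH] A mA /=.
  by rewrite big_ord0 /dirac/= indicE mem_set// => -[].
rewrite big_ord_recl /measure_cons /pushforward.
rewrite (_ : _ @^-1` _ = A ord0 `*`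
    [set t | forall i, A (lift ord0 i) (tnth t i)]); last first.
  apply/seteqP; split=> -[x t] /=.
    move=> H; split; first by have := H ord0.
    by move=> i; have := H (lift ord0 i); rewrite tnthS.
  move=> [Ax At] i; have [j ->|->] := unliftP ord0 i; last by [].
  by rewrite tnthS.
have mB : measurable [set t : n.-tuple R | forall i, A (lift ord0 i) (tnth t i)].
  rewrite [X in measurable X](_ : _ = \bigcap_(i in [set: 'I_n])
      (fun t : n.-tuple R => tnth t i) @^-1` A (lift ord0 i)); last first.
    by apply/seteqP; split=> t /= H i; [move=> _|]; exact: H.
  apply: fin_bigcap_measurable => // i _; rewrite -[X in measurable X]setTI.
  exact: measurable_tnth.
rewrite product_measure1E; [|exact: mA|exact: mB].
congr (_ * _)%E.
exact: (IH _ (fun i => mA (lift ord0 i))).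
Qed.

End LebesgueTuple.

Section LebesgueCol.
Variables (R : realType) (n : nat).

Definition col_of_tuple (t : n.-tuple R) : borel 'cV[R]_n := \col_i tnth t i.

Lemma measurable_col_of_tuple : measurable_fun setT col_of_tuple.
Proof.
apply: (@measurability _ _ _ _ setT col_of_tuple (@open 'cV[R]_n)) => //.
move=> _ [U oU <-]; rewrite setTI.
pose box (p : {ffun 'I_n -> rat * rat}) : set (n.-tuple R) :=
  \bigcap_(i in [set: 'I_n])
    (fun t => tnth t i) @^-1` ball (ratr (p i).1 : R) (ratr (p i).2).
pose F p := if `[< box p `<=` col_of_tuple @^-1` U >] then box p else set0.
rewrite (_ : _ @^-1` _ = \bigcup_p F p); last first.
  apply/seteqP; split=> [t Ut|t [p _]]; last first.
    by rewrite /F; case: asboolP => // + pt; exact.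
  have [P tP PU] : nbhs (col_of_tuple t : 'cV[R]_n) U.
    exact: open_nbhs_nbhs.
  have /choice[p pP] : forall i : 'I_n, exists p : rat * rat,
      ball (ratr p.1 : R) (ratr p.2) (tnth t i) /\
      ball (ratr p.1 : R) (ratr p.2) `<=` P i 0.
    move=> i; have /= := tP i 0; rewrite mxE => Pi.
    have /mem_set ti := nbhs_singleton (nbhs_interior Pi).
    have [c [r [/set_mem tB BP]]] := open_subball_rat (@open_interior _ _) ti.
    exists (c, r); split => //; exact: subset_trans (@interior_subset _ _).
  exists (finfun p) => //; rewrite /F; case: asboolP => [_ i _ /=|[]].
    by rewrite ffunE; have [] := pP i.
  move=> s ps; apply: PU => i j; rewrite (ord1 j) mxE.
  by have [_] := pP i; apply; have := ps i I; rewrite /= ffunE.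
apply: countable_bigcupT_measurable => [|p]; first exact: countableP.
rewrite /F; case: asboolP => // _.
apply: fin_bigcap_measurable => // i _.
rewrite -[X in measurable X]setTI; apply: measurable_tnth => //.
by apply: open_measurable; exact: ball_open.
Qed.

Definition lebesgue_cV : set (borel 'cV[R]_n) -> \bar R :=
  pushforward (lebesgue_tuple R n) col_of_tuple.

HB.instance Definition _ := Measure.copy lebesgue_cV
  (measure_function_pushforward__canonical__measure_function_Measure
    (lebesgue_tuple R n) measurable_col_of_tuple).

End LebesgueCol.

Section Haar.
Variables (R : realType) (G : topologicalGroupType).
Implicit Types mu : {measure set (borel G) -> \bar R}.

Definition left_invariant mu :=
  forall (g : G) (A : set G), measurable (A : set (borel G)) ->
    mu [set (g * x)%g | x in A] = mu A.

Definition right_invariant mu :=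
  forall (g : G) (A : set G), measurable (A : set (borel G)) ->
    mu [set (x * g)%g | x in A] = mu A.

Definition radon mu :=
  [/\ forall K : set G, compact K -> (mu K < +oo)%E,
      forall A : set G, measurable (A : set (borel G)) ->
        mu A = ereal_inf [set mu U | U in [set U : set G | open U /\ A `<=` U]]
    & forall U : set G, open U ->
        mu U = ereal_sup [set mu K | K in [set K : set G | compact K /\ K `<=` U]]].

Definition left_haar mu :=
  [/\ radon mu, mu setT != 0%E & left_invariant mu].

End Haar.

(* Left Haar measures are unique up to scaling, so the modular function is
   trivial iff one, equivalently every, left Haar measure is right-invariant. *)
Definition unimodular (R : realType) (G : topologicalGroupType) :=
  forall mu : {measure set (borel G) -> \bar R},
    left_haar mu -> right_invariant mu.

Section ComplexL2.
Context d (T : measurableType d) (R : realType).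
Variable mu : {measure set T -> \bar R}.
Implicit Types f g : T -> R[i].

(* With T = borel 'cV[R]_n this asks for Borel measurability, which loses
   nothing: every Lebesgue class has a Borel representative. *)
Definition cmeasurable f :=
  measurable_fun setT (fun x => complex.Re (f x)) /\
  measurable_fun setT (fun x => complex.Im (f x)).

Definition normL2 f : \bar R := Lnorm mu 2%:E (fun x => (Normc.normc (f x))%:E).

Definition inL2 f := cmeasurable f /\ (normL2 f < +oo)%E.

Definition cintegral f : R[i] :=
  (Rintegral mu setT (fun x => complex.Re (f x)) +i*
   Rintegral mu setT (fun x => complex.Im (f x)))%C.

Definition innerL2 f g : R[i] := cintegral (fun x => f x * (g x)^*%C).

End ComplexL2.

(* Elements of L^2 are represented by functions; as the norm of the difference
   is a pseudometric, [U] automatically respects almost everywhere equality. *)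
Definition isometryL2 d1 d2 (T1 : measurableType d1) (T2 : measurableType d2)
    (R : realType) (mu1 : {measure set T1 -> \bar R})
    (mu2 : {measure set T2 -> \bar R}) (U : (T1 -> R[i]) -> (T2 -> R[i])) :=
  (forall f, inL2 mu1 f -> inL2 mu2 (U f)) /\
  (forall f g, inL2 mu1 f -> inL2 mu1 g ->
     normL2 mu2 (fun y => U f y - U g y) = normL2 mu1 (fun x => f x - g x)).

Section Wavelet.
Variables (R : realType) (n : nat).
Implicit Types (f psi : 'cV[R]_n -> R[i]).

Definition translation (x : 'cV[R]_n) f : 'cV[R]_n -> R[i] :=
  fun y => f (y - x).

Definition modulation (xi : 'cV[R]_n) f : 'cV[R]_n -> R[i] :=
  fun y => \val (e2pi (dotv y xi)) * f y.

Definition dilation (h : GL R n) f : 'cV[R]_n -> R[i] :=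
  fun y => ((Num.sqrt `|\det (\val h)|)^-1)%:C%C * f (invmx (\val h) *m y).

Definition quasi_regular (g : aWH R n) f : 'cV[R]_n -> R[i] :=
  fun y => \val (aWH_z g) *
    translation (aWH_x g) (modulation (aWH_xi g) (dilation (aWH_h g) f)) y.

Variable G : tcSubgroup R n.

Definition wavelet_transform psi f : borel (tcType G) -> R[i] :=
  fun g => innerL2 (@lebesgue_cV R n) f (quasi_regular (\val (g : tcType G)) psi).

Variable mu : {measure set (borel (tcType G)) -> \bar R}.

Definition admissible_vector psi :=
  exists c : R[i], c != 0 /\
  exists U : ('cV[R]_n -> R[i]) -> (tcType G -> R[i]),
    isometryL2 (@lebesgue_cV R n) mu U /\
    forall f, inL2 (@lebesgue_cV R n) f ->
      {ae mu, forall g, wavelet_transform psi f g = c * U f g}.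

Definition admissible :=
  exists2 psi, inL2 (@lebesgue_cV R n) psi & admissible_vector psi.

End Wavelet.

(* Main.v *)
(* Let alpha be the automorphism (z, x, xi, h) |-> (z, x/2, 2 xi, h) of G.  Since
   G is unimodular, the invariant measure mu is also invariant under inversion,
   and a Fubini argument shows that composing with alpha multiplies mu-integrals
   by the constant 2^n / 2^d, where d = dim V < n.  If psi were admissible with
   constant K, put f1(y) = psi(2y) and f2(y) = psi(y/2).  An affine change of
   variables gives V_psi f1(alpha g) = 2^-n (V_psi f2(g^-1))^*, so integrating
   the squared modulus over G yields
   (2^n / 2^d) K 2^-n |psi|^2 = 4^-n K 2^n |psi|^2, that is d = n. *)

Require Import Defs.
From HB Require Import structures.
From mathcomp Require Import all_boot all_order all_algebra.
From mathcomp Require Import fingroup perm complex ring lra.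
From mathcomp Require Import all_classical all_reals all_analysis.
From mathcomp Require Import measurable_realfun.

Set Implicit Arguments.
Unset Strict Implicit.
Unset Printing Implicit Defensive.

Import Order.TTheory GRing.Theory Num.Theory numFieldNormedType.Exports.

Local Open Scope classical_set_scope.
Local Open Scope ring_scope.

(** * Invariant integrals *)

(** The map alpha is conjugation by the scalar matrix 1/2, which commutes with [H] and preserves
    [V], and therefore normalizes [G] whether or not it lies in [H]. If D denotes the operator
    taking psi to f1, then D pi(g) D^-1 = pi(alpha g) and f2 = D^-1 psi, so <D psi, pi(alpha g) psi>
    = 2^-n <psi, pi(g) D^-1 psi>. Moving pi(g) to the other side turns this into a transform of f2
    at g^-1: both sides are transforms with the same psi, so its admissibility controls both
    energies. The obstacle is that mu is known only through its invariance, not as a product of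
    Lebesgue measures in position and frequency with a measure on [H]. The Fubini argument is
    therefore an exchange identity between two test functions: it shows that alpha scales all
    integrals by one constant, and a test function adapted to shifts in position and frequency
    reveals that constant. Frequency shifts act from the right, so unimodularity enters there too.
    Any positive number other than 1 could replace 2, since its powers separate n from d. *)

Section Fubini.
Local Open Scope ereal_scope.
Context d (T : measurableType d) (R : realType).

(** Invariance is phrased with nonnegative functions because it is applied to the inner integral of
    iterated integrals, where Tonelli's theorem asks for nothing more. *)
Definition preserves (mu : {measure set T -> \bar R}) (phi : T -> T) :=
  forall f : T -> \bar R, measurable_fun setT f -> (forall x, 0 <= f x) ->
    \int[mu]_x f (phi x) = \int[mu]_x f x.

Lemma preserves_measure (mu : {measure set T -> \bar R}) (phi : T -> T) :
  measurable_fun setT phi ->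
  (forall A, measurable A -> mu (phi @^-1` A) = mu A) -> preserves mu phi.
Proof.
move=> mphi phiA f mf f0.
rewrite -[LHS](@ge0_integral_pushforward _ _ _ _ _ _ mphi mu setT f)//.
by apply: eq_measure_integral => A mA _; rewrite -[RHS]phiA.
Qed.

Lemma measurable_fun_comp d1 d2 d3 (X : measurableType d1) (Y : measurableType d2)
    (Z : measurableType d3) (f : X -> Y) (g : Y -> Z) :
  measurable_fun setT g -> measurable_fun setT f ->
  measurable_fun setT (fun x => g (f x)).
Proof. by move=> mg mf; exact: measurableT_comp. Qed.

Variable mu : {sigma_finite_measure set T -> \bar R}.
Variables (mul : T -> T -> T) (inv : T -> T) (alpha beta : T -> T).
Hypothesis mmul : measurable_fun setT (fun p : T * T => mul p.1 p.2).
Hypothesis minv : measurable_fun setT inv.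
Hypothesis malpha : measurable_fun setT alpha.
Hypothesis mulK : forall x y, mul (inv x) (mul x y) = y.
Hypothesis invMV : forall x y, inv (mul (inv x) y) = mul (inv y) x.
(** [beta] stands for the inverse of the automorphism [alpha]. The hypotheses cover both the
    additive group of column vectors with an invertible matrix as [alpha], and the group [G] with a
    dilation. *)
Hypothesis alphaM : forall h g, alpha (mul (beta h) g) = mul h (alpha g).
Hypothesis mulP : forall h, preserves mu (mul h).
Hypothesis mulrP : forall h, preserves mu (mul ^~ h).

(* For [alpha := id] this is invariance under inversion; for an automorphism
   [alpha] it says that composition with [alpha] scales all integrals alike. *)
Lemma twisted_haar_unique (F u : T -> \bar R) :
  measurable_fun setT F -> (forall x, 0 <= F x) ->
  measurable_fun setT u -> (forall x, 0 <= u x) ->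
  \int[mu]_g F (alpha g) * \int[mu]_h u h =
  \int[mu]_g u (alpha g) * \int[mu]_h F (inv h).
Proof.
move=> mF F0 mu_ u0.
have mFa : measurable_fun setT (fun g => F (alpha g)) by exact: measurable_fun_comp.
have mua : measurable_fun setT (fun g => u (alpha g)) by exact: measurable_fun_comp.
have mpair (f g : T * T -> T) : measurable_fun setT f -> measurable_fun setT g ->
    measurable_fun setT (fun p => mul (f p) (g p)).
  move=> mf mg; apply: (measurable_fun_comp mmul (f := fun p => (f p, g p))).
  exact: measurable_fun_pair.
have ma1 : measurable_fun setT (fun p : T * T => alpha p.1).
  exact: (measurable_fun_comp malpha measurable_fst).
(* Right invariance in [h] produces the kernel [P1], translating [g] by [beta h] turns [P1] into
   [P2], and left invariance in [h] finally removes [alpha g] from the argument of [F]. *)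
pose P1 (p : T * T) := F (alpha p.1) * u (mul p.2 (alpha p.1)).
pose P2 (p : T * T) := F (mul (inv p.2) (alpha p.1)) * u (alpha p.1).
have mP1 : measurable_fun setT P1.
  apply: emeasurable_funM; first exact: (measurable_fun_comp mF).
  by apply: (measurable_fun_comp mu_); exact: mpair.
have mP2 : measurable_fun setT P2.
  apply: emeasurable_funM; last exact: (measurable_fun_comp mu_).
  apply: (measurable_fun_comp mF); apply: mpair => //.
  exact: (measurable_fun_comp minv measurable_snd).
have P10 p : 0 <= P1 p by rewrite mule_ge0.
have P20 p : 0 <= P2 p by rewrite mule_ge0.
transitivity (\int[mu]_g \int[mu]_h P1 (g, h)).
  rewrite -ge0_integralZr//; last exact: integral_ge0.
  apply: eq_integral => g _; rewrite -[in LHS](mulrP (alpha g))//.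
  rewrite -ge0_integralZl//.
  by apply: (measurable_fun_comp mu_); exact: (measurable_fun_comp mmul (pair2_measurable _)).
rewrite fubini_tonelli//.
transitivity (\int[mu]_h \int[mu]_g P2 (g, h)).
  apply: eq_integral => h _.
  rewrite -[RHS](mulP (beta h))//; last first.
    exact: (measurable_fun_comp mP2 (pair2_measurable _)).
  by apply: eq_integral => g _; rewrite /P1 /P2/= alphaM mulK.
rewrite -fubini_tonelli//.
rewrite -ge0_integralZr//; last exact: integral_ge0.
apply: eq_integral => g _; rewrite /P2/= muleC ge0_integralZr//; last first.
  apply: (measurable_fun_comp mF); apply: (measurable_fun_comp mmul (f := fun h => (inv h, alpha g))).
  exact: measurable_fun_pair.
congr (_ * _).
rewrite -[RHS](mulP (inv (alpha g)))//; last exact: (measurable_fun_comp mF).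
by apply: eq_integral => h _; rewrite invMV.
Qed.

End Fubini.

(** * Averages over an action, and unfolding *)

Section ActionAverage.
Local Open Scope ereal_scope.
Context d d' (T : measurableType d) (S : measurableType d') (R : realType).
Variables (mu : {sigma_finite_measure set T -> \bar R}).
Variables (lam : {sigma_finite_measure set S -> \bar R}).
Variables (act : S -> T -> T) (q : T -> S) (sub : S -> S -> S).
Hypothesis mact : measurable_fun setT (fun p : S * T => act p.1 p.2).
Hypothesis mq : measurable_fun setT q.
Hypothesis msub : measurable_fun setT (fun p : S * S => sub p.1 p.2).
Hypothesis actP : forall t, preserves mu (act t).
Hypothesis qact : forall t g, sub (q (act t g)) t = q g.
Hypothesis subP : forall s, preserves lam (sub s).

Definition average (w : T -> \bar R) (g : T) := \int[lam]_t w (act t g).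

Lemma measurable_average w : measurable_fun setT w -> (forall x, 0 <= w x) ->
  measurable_fun setT (average w).
Proof.
move=> mw w0.
apply: (@measurable_fun_fubini_tonelli_F _ _ _ _ _ lam
  (fun p : T * S => w (act p.2 p.1))) => //.
apply: (measurable_fun_comp mw).
apply: (measurable_fun_comp mact (f := fun p : T * S => (p.2, p.1))).
exact: measurable_swap.
Qed.

Lemma average_ge0 w : (forall x, 0 <= w x) -> forall g, 0 <= average w g.
Proof. by move=> w0 g; exact: integral_ge0. Qed.

(** Unfolding: replacing [g] by [act t g] moves the parameter [t] from [w] into [b], and the inner
    integral over [t] then no longer depends on [g], by [subP]. *)
Lemma integral_average (w : T -> \bar R) (b : S -> \bar R) :
  measurable_fun setT w -> (forall x, 0 <= w x) ->
  measurable_fun setT b -> (forall x, 0 <= b x) ->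
  \int[mu]_g (b (q g) * average w g) = \int[mu]_g w g * \int[lam]_t b t.
Proof.
move=> mw w0 mb b0.
pose P1 (p : T * S) := b (q p.1) * w (act p.2 p.1).
pose P2 (p : T * S) := b (sub (q p.1) p.2) * w p.1.
have P10 p : 0 <= P1 p by rewrite mule_ge0.
have P20 p : 0 <= P2 p by rewrite mule_ge0.
have mqf : measurable_fun setT (fun p : T * S => q p.1).
  exact: (measurable_fun_comp mq measurable_fst).
have mP1 : measurable_fun setT P1.
  apply: emeasurable_funM; first exact: (measurable_fun_comp mb).
  apply: (measurable_fun_comp mw).
  apply: (measurable_fun_comp mact (f := fun p : T * S => (p.2, p.1))).
  exact: measurable_swap.
have mP2 : measurable_fun setT P2.
  apply: emeasurable_funM; last exact: (measurable_fun_comp mw).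
  apply: (measurable_fun_comp mb).
  apply: (measurable_fun_comp msub (f := fun p : T * S => (q p.1, p.2))).
  exact: measurable_fun_pair.
transitivity (\int[mu]_g \int[lam]_t P1 (g, t)).
  apply: eq_integral => g _; rewrite /P1/= ge0_integralZl//.
  by apply: (measurable_fun_comp mw); exact: (measurable_fun_comp mact (pair2_measurable g)).
rewrite fubini_tonelli//.
transitivity (\int[lam]_t \int[mu]_g P2 (g, t)).
  apply: eq_integral => t _.
  rewrite -[RHS](actP t)//; last exact: (measurable_fun_comp mP2 (pair2_measurable _)).
  by apply: eq_integral => g _; rewrite /P1 /P2/= qact.
rewrite -fubini_tonelli//.
rewrite -ge0_integralZr//; last exact: integral_ge0.
apply: eq_integral => g _; rewrite /P2/= ge0_integralZr//; last first.
  by apply: (measurable_fun_comp mb); exact: (measurable_fun_comp msub (pair1_measurable _)).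
by rewrite muleC; congr (_ * _); exact: subP.
Qed.

End ActionAverage.

(** * Borel sets of spaces with finitely many real coordinates *)

Section Coordinates.
Variables (R : realType) (T : topologicalType) (I : finType).
Variable phi : I -> T -> R.

(** The half of the statement that [phi] induces the topology which continuity of the coordinates
    does not give. It makes countably many rational boxes a base, once the coordinates are
    continuous. *)
Definition coord_nbhs := forall (t : T) (U : set T), nbhs t U ->
  exists2 e : R, 0 < e & [set s | forall i, `|phi i t - phi i s| < e] `<=` U.

Definition rat_box (p : {ffun I -> rat * rat}) : set T :=
  \bigcap_(i in [set: I]) phi i @^-1` ball (ratr (p i).1 : R) (ratr (p i).2).

Lemma coord_nbhs_rat_box t U : coord_nbhs -> nbhs t U ->
  exists p, rat_box p t /\ rat_box p `<=` U.
Proof.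
move=> cT /cT[e e0 eU].
have /choice[p pP] : forall i : I, exists p : rat * rat,
    ball (ratr p.1 : R) (ratr p.2) (phi i t) /\
    ball (ratr p.1 : R) (ratr p.2) `<=` ball (phi i t) e.
  move=> i; have /mem_set ti : ball (phi i t) e (phi i t) by exact: ballxx.
  have [c [r [/set_mem tB BP]]] := open_subball_rat (ball_open _ _) ti.
  by exists (c, r).
exists (finfun p); split=> [i _|s ps]; first by rewrite /= ffunE; have [] := pP i.
apply: eU => i; have [_] := pP i; apply.
by have := ps i Logic.I; rewrite /= ffunE.
Qed.

Lemma measurable_rat_box d (X : measurableType d) (f : X -> T) p :
  (forall i, measurable_fun setT (fun x => phi i (f x))) ->
  measurable (f @^-1` rat_box p).
Proof.
move=> mf; rewrite /rat_box preimage_bigcap; apply: fin_bigcap_measurable => // i _.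
rewrite -comp_preimage -[X in measurable X]setTI; apply: mf => //.
by apply: open_measurable; exact: ball_open.
Qed.

(** An open set is the union of the rational boxes that it contains, and there are only countably
    many of them. *)
Lemma measurable_preimage_open d (X : measurableType d) (f : X -> T) (U : set T) :
  coord_nbhs -> (forall i, measurable_fun setT (fun x => phi i (f x))) ->
  open U -> measurable (f @^-1` U).
Proof.
move=> cT mf oU.
rewrite (_ : _ @^-1` _ = \bigcup_p
    (if `[< rat_box p `<=` U >] then f @^-1` rat_box p else set0)); last first.
  apply/seteqP; split=> [x Ux|x [p _]]; last first.
    by case: asboolP => // + px; apply.
  have [p [pt pU]] := coord_nbhs_rat_box cT (open_nbhs_nbhs (conj oU Ux)).
  by exists p => //; case: asboolP.
apply: countable_bigcupT_measurable => [|p]; first exact: countableP.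
by case: asboolP => // _; exact: measurable_rat_box.
Qed.

End Coordinates.

Lemma measurable_fun_borel d (X : measurableType d) (T : ptopologicalType)
    (f : X -> borel T) :
  (forall U : set T, open U -> measurable (f @^-1` U)) -> measurable_fun setT f.
Proof.
move=> mf; apply: (@measurability _ _ _ _ setT f (@open T)) => // _ [U oU <-].
by rewrite setTI; exact: mf.
Qed.

Lemma measurable_fun_coord (R : realType) (T : ptopologicalType) (I : finType)
    (phi : I -> T -> R) d (X : measurableType d) (f : X -> borel T) :
  coord_nbhs phi -> (forall i, measurable_fun setT (fun x => phi i (f x))) ->
  measurable_fun setT f.
Proof.
by move=> cT mf; apply: measurable_fun_borel => U; exact: measurable_preimage_open cT mf.
Qed.

Lemma measurable_continuous (T T' : ptopologicalType) (f : T -> T') :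
  continuous f -> measurable_fun setT (f : borel T -> borel T').
Proof.
move=> /continuousP cf; apply: measurable_fun_borel => U oU.
by apply: sub_sigma_algebra; exact: cf.
Qed.

Lemma measurable_continuous_real (R : realType) (T : ptopologicalType) (f : T -> R) :
  continuous f -> measurable_fun setT (f : borel T -> R).
Proof.
move=> /continuousP cf.
apply: (measurability (@RGenOpens.G R)); first exact: RGenOpens.measurableE.
move=> _ [_ [a [b ->] <-]]; rewrite setTI; apply: sub_sigma_algebra.
by apply: cf; exact: interval_open.
Qed.

Section CoordNbhs.
Variable R : realType.

Lemma coord_nbhs_real : coord_nbhs (fun (_ : unit) (x : R) => x).
Proof.
by move=> t U /nbhs_ballP[e /= e0 eU]; exists e => // s /(_ tt); exact: eU.
Qed.

Lemma coord_nbhs_mx m n :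
  coord_nbhs (fun (ij : 'I_m * 'I_n) (A : 'M[R]_(m, n)) => A ij.1 ij.2).
Proof.
move=> t U [P tP PU].
have /choice[e eP] : forall ij : 'I_m * 'I_n, exists e : R,
    0 < e /\ ball (t ij.1 ij.2) e `<=` P ij.1 ij.2.
  by move=> ij; have /nbhs_ballP[e e0 eP] := tP ij.1 ij.2; exists e.
exists (\big[Num.min/1]_ij e ij) => [|s st].
  by apply: lt_bigmin => // ij _; have [] := eP ij.
apply: PU => i j; have [_] := eP (i, j); apply.
by apply: lt_le_trans (st (i, j)) _; exact: bigmin_le_cond.
Qed.

Lemma coord_nbhs_prod (T1 T2 : topologicalType) (I1 I2 : finType)
    (phi1 : I1 -> T1 -> R) (phi2 : I2 -> T2 -> R) :
  coord_nbhs phi1 -> coord_nbhs phi2 ->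
  coord_nbhs (fun (i : I1 + I2) (t : T1 * T2) =>
    match i with inl i => phi1 i t.1 | inr i => phi2 i t.2 end).
Proof.
move=> c1 c2 [t1 t2] U [[U1 U2] /= [/c1[e1 e10 e1U] /c2[e2 e20 e2U]] UU].
exists (Num.min e1 e2) => [|[s1 s2] st]; first by rewrite lt_min e10.
apply: UU; split; [apply: e1U|apply: e2U] => i.
  by apply: lt_le_trans (st (inl i)) _; rewrite ge_min lexx.
by apply: lt_le_trans (st (inr i)) _; rewrite ge_min lexx orbT.
Qed.

Lemma coord_nbhs_initial (S : choiceType) (T : topologicalType) (f : S -> T)
    (I : finType) (phi : I -> T -> R) :
  coord_nbhs phi ->
  coord_nbhs (T := initial_topology f) (fun i t => phi i (f t)).
Proof.
move=> cT t U; rewrite nbhsE => -[V [[W oW <-] /= Wt] VU].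
have [e e0 eW] := cT _ _ (open_nbhs_nbhs (conj oW Wt)).
by exists e => // s st; apply: VU; exact: eW.
Qed.

(** The source carries the product of two Borel sigma-algebras, which need not contain every open
    set of the product topology in general; the coordinates of both factors ensure that it does
    here. *)
Lemma measurable_continuous2 (T1 T2 T3 : ptopologicalType) (I1 I2 : finType)
    (phi1 : I1 -> T1 -> R) (phi2 : I2 -> T2 -> R) (f : T1 * T2 -> T3) :
  coord_nbhs phi1 -> coord_nbhs phi2 ->
  (forall i, continuous (phi1 i)) -> (forall i, continuous (phi2 i)) ->
  continuous f -> measurable_fun setT (f : borel T1 * borel T2 -> borel T3).
Proof.
move=> c1 c2 k1 k2 /continuousP cf; apply: measurable_fun_borel => U /cf.
apply: (measurable_preimage_open (f := fun p : borel T1 * borel T2 => (p : T1 * T2))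
  (coord_nbhs_prod c1 c2)) => -[i|i].
  exact: (measurableT_comp (measurable_continuous_real (k1 i)) measurable_fst).
exact: (measurableT_comp (measurable_continuous_real (k2 i)) measurable_snd).
Qed.

End CoordNbhs.

(** * Lebesgue measure on column vectors *)

Section LebesgueColumn.
Variable R : realType.

Lemma lebesgue_measure_shift (c : R) (A : set R) : measurable A ->
  lebesgue_measure ((fun x => x + c) @^-1` A) = lebesgue_measure A.
Proof.
move=> mA.
have mf : measurable_fun setT (fun x : measurableTypeR R => x + c : measurableTypeR R).
  exact: measurable_funD.
pose m : {measure set (measurableTypeR R) -> \bar R} :=
  (measure_function_pushforward__canonical__measure_function_Measure
    (@lebesgue_measure R) mf).
symmetry; apply: (@lebesgue_measure_unique R m) => // _ [[a b]] _ <-.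
rewrite [RHS](_ : _ = lebesgue_measure `]a - c, b - c]%classic).
  rewrite !lebesgue_measure_itv/= !lte_fin ltrD2r.
  by case: ifPn => // _; rewrite -!EFinB opprB addrA subrK.
rewrite /m /= /pushforward; congr lebesgue_measure.
by apply/seteqP; split => x /=; rewrite !in_itv/= ltrBlDr lerBrDr.
Qed.

Section Col.
Variable n : nat.
Notation lam := (@lebesgue_cV R n).

Lemma measurable_entry (i : 'I_n) :
  measurable_fun setT (fun y : borel 'cV[R]_n => y i 0).
Proof.
apply: (@measurable_continuous_real R 'cV[R]_n (fun y => y i 0)).
exact: entry_continuous.
Qed.

Lemma measurable_fun_cV d (X : measurableType d) (f : X -> borel 'cV[R]_n) :
  (forall i, measurable_fun setT (fun x => f x i 0)) -> measurable_fun setT f.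
Proof.
move=> mf; apply: (measurable_fun_coord (@coord_nbhs_mx R n 1)) => -[i j] /=.
by rewrite (ord1 j); exact: mf.
Qed.

Lemma measurable_cV_box (A : 'I_n -> set R) : (forall i, measurable (A i)) ->
  measurable ([set y | forall i, A i (y i 0)] : set (borel 'cV[R]_n)).
Proof.
move=> mA; rewrite [X in measurable X](_ : _ = \bigcap_(i in [set: 'I_n])
  (fun y : borel 'cV[R]_n => y i 0) @^-1` A i); last first.
  by apply/seteqP; split=> t /= H i; [move=> _|]; exact: H.
apply: fin_bigcap_measurable => // i _; rewrite -[X in measurable X]setTI.
exact: measurable_entry.
Qed.

Lemma lebesgue_cV_box (A : 'I_n -> set R) : (forall i, measurable (A i)) ->
  lam [set y | forall i, A i (y i 0)] = (\prod_(i < n) @lebesgue_measure R (A i))%E.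
Proof.
move=> mA; rewrite -lebesgue_tuple_prod//; congr (lebesgue_tuple R n _).
by apply/seteqP; split=> t /= + i => /(_ i); rewrite mxE.
Qed.

Definition cube (r : R) : set 'cV[R]_n := [set y | forall i, `|y i 0| <= r].

Lemma measurable_norm_le (r : R) : measurable [set x : R | `|x| <= r].
Proof.
rewrite (_ : [set x : R | _] = `[- r, r]%classic) //.
by apply/seteqP; split=> x /=; rewrite in_itv/= ler_norml.
Qed.

Lemma measurable_cube r : measurable (cube r : set (borel 'cV[R]_n)).
Proof.
apply: (@measurable_cV_box (fun=> [set x | `|x| <= r])) => _.
exact: measurable_norm_le.
Qed.

Lemma lebesgue_cV_rect (r : 'I_n -> R) : (forall i, 0 <= r i) ->
  lam [set y | forall i, `|y i 0| <= r i] = (\prod_i (2 * r i))%:E.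
Proof.
move=> r0; rewrite (lebesgue_cV_box (A := fun i => [set x | `|x| <= r i])); last first.
  by move=> i; exact: measurable_norm_le.
rewrite -prodEFin; apply: eq_bigr => i _.
rewrite (_ : [set x : R | _] = `[- r i, r i]%classic); last first.
  by apply/seteqP; split=> x /=; rewrite in_itv/= ler_norml.
rewrite lebesgue_measure_itv/= lte_fin.
case: ltP => [_|ri]; first by rewrite -EFinB opprK mulr2n mulrDl mul1r.
have -> : r i = 0 by apply/eqP; rewrite eq_le r0 andbT; lra.
by rewrite mulr0.
Qed.

Lemma lebesgue_cV_cube r : 0 <= r -> lam (cube r) = ((2 * r) ^+ n)%:E.
Proof.
by move=> r0; rewrite lebesgue_cV_rect// prodr_const card_ord.
Qed.

Lemma cube_cover (y : 'cV[R]_n) : exists k : nat, cube k%:R y.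
Proof.
exists (\max_i (Num.truncn `|y i 0%R|).+1) => i.
by apply/ltW/(lt_le_trans (truncnS_gt _)); rewrite ler_nat; exact: (leq_bigmax i).
Qed.

Lemma cube_sub r s : r <= s -> cube r `<=` cube s.
Proof. by move=> rs y yr i; exact: le_trans (yr i) rs. Qed.

Lemma lebesgue_cV_sigma_finite : sigma_finite setT lam.
Proof.
exists (fun k : nat => cube k%:R) => [|k].
  by apply/esym; rewrite -subTset => y _; have [k yk] := cube_cover y; exists k.
split; first exact: measurable_cube.
by apply: (@le_lt_trans _ _ ((2 * k%:R) ^+ n)%:E); rewrite ?ltry// lebesgue_cV_cube.
Qed.

HB.instance Definition _ :=
  Measure_isSigmaFinite.Build _ _ _ (@lebesgue_cV R n) lebesgue_cV_sigma_finite.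

(** Boxes are stable under intersection and generate the sigma-algebra of tuples, and the cubes of
    integer radius exhaust the space with finite measure. *)
Lemma lebesgue_tuple_unique (m : {measure set (n.-tuple R) -> \bar R}) :
  (forall A : 'I_n -> set R, (forall i, measurable (A i)) ->
    m [set t | forall i, A i (tnth t i)] = (\prod_(i < n) lebesgue_measure (A i))%E) ->
  forall A, measurable A -> lebesgue_tuple R n A = m A.
Proof.
move=> mbox A mA.
pose box (B : 'I_n -> set R) : set (n.-tuple R) := [set t | forall i, B i (tnth t i)].
pose G := [set box B | B in [set B | forall i, measurable (B i)]].
apply: (measure_unique G (fun k : nat => box (fun=> [set x | `|x| <= k%:R]))) => //.
- apply/seteqP; split; last first.
    apply: smallest_sub; first exact: sigma_algebra_measurable.
    move=> _ [B mB <-].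
    rewrite [X in measurable X](_ : _ = \bigcap_(i in [set: 'I_n])
      (fun t : n.-tuple R => tnth t i) @^-1` B i); last first.
      by apply/seteqP; split=> t /= H i; [move=> _|]; exact: H.
    apply: fin_bigcap_measurable => // i _; rewrite -[X in measurable X]setTI.
    by apply: measurable_tnth => //; exact: mB.
  apply: smallest_sub; first exact: smallest_sigma_algebra.
  rewrite -bigcup_seq => _ [i _ [B mB <-]]; apply: sub_sigma_algebra.
  exists (fun j => if j == i then B else setT) => [j /=|].
    by case: ifP.
  rewrite setTI; apply/seteqP; split=> t /=; first by move/(_ i); rewrite eqxx.
  by move=> Bt j; case: eqP => // ->.
- move=> _ _ [B mB <-] [C mC <-]; exists (fun i => B i `&` C i).
    by move=> i; apply: measurableI; [exact: mB|exact: mC].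
  by apply/seteqP; split=> t /=; [move=> H; split=> i; case: (H i)|
    move=> [Bt Ct] i; split; [exact: Bt|exact: Ct]].
- by move=> k; exists (fun=> [set x | `|x| <= k%:R]) => // _; exact: measurable_norm_le.
- rewrite -subTset => t _.
  pose k := \max_i (Num.truncn `|tnth t i|).+1.
  exists k => // i; apply/ltW/(lt_le_trans (truncnS_gt _)).
  by rewrite ler_nat; exact: (leq_bigmax i).
- by move=> _ [B mB <-]; rewrite mbox//; exact: lebesgue_tuple_prod.
- move=> k; apply: (@le_lt_trans _ _ (lam (cube k%:R))); last first.
    by rewrite lebesgue_cV_cube// ltry.
  rewrite /= /lebesgue_cV/= /pushforward le_eqVlt; apply/orP; left; apply/eqP.
  by congr (lebesgue_tuple R n _); apply/seteqP; split=> t /= + i => /(_ i); rewrite mxE.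
Qed.

(** By uniqueness it suffices to compare measures of boxes, where the claim is the one-dimensional
    shift invariance in each coordinate. *)
Lemma lebesgue_cV_shift (c : 'cV[R]_n) : preserves lam (fun y => y + c).
Proof.
have ms : measurable_fun setT (fun y : borel 'cV[R]_n => y + c : borel 'cV[R]_n).
  apply: measurable_fun_cV => i; under eq_fun do rewrite mxE.
  by apply: measurable_funD => //; exact: measurable_entry.
apply: preserves_measure => // A mA.
pose tau (t : n.-tuple R) : n.-tuple R := [tuple tnth t i + c i 0 | i < n].
have mtau : measurable_fun setT tau.
  apply/measurable_fun_tnthP => i.
  rewrite (_ : _ \o _ = (fun t => tnth t i + c i 0)); last first.
    by apply/funext => t /=; rewrite tnth_mktuple.
  by apply: measurable_funD => //; exact: measurable_tnth.
pose m : {measure set (n.-tuple R) -> \bar R} :=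
  (measure_function_pushforward__canonical__measure_function_Measure
    (lebesgue_tuple R n) mtau).
rewrite /lebesgue_cV /= /pushforward.
transitivity (m (@col_of_tuple R n @^-1` A)).
  rewrite /m /= /pushforward; congr (lebesgue_tuple R n _).
  apply/seteqP; split=> t /=; rewrite (_ : col_of_tuple t + c = col_of_tuple (tau t))//;
    by apply/matrixP => i j; rewrite !mxE tnth_mktuple (ord1 j).
symmetry; apply: lebesgue_tuple_unique; last first.
  by rewrite -[X in measurable X]setTI; exact: measurable_col_of_tuple.
move=> B mB; rewrite /m /= /pushforward.
rewrite (_ : tau @^-1` _ = [set t | forall i, ((fun x => x + c i 0) @^-1` B i) (tnth t i)]);
  last first.
  by apply/seteqP; split=> t /= + i => /(_ i); rewrite tnth_mktuple.
rewrite (@lebesgue_tuple_prod R n (fun i => (fun x => x + c i 0) @^-1` B i)).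
  by apply: eq_bigr => i _; rewrite lebesgue_measure_shift.
by move=> i; rewrite -[X in measurable X]setTI; exact: measurable_funD.
Qed.

End Col.

Section Product.
Variables (n d : nat).
Local Notation S := (borel 'cV[R]_n * borel 'cV[R]_d)%type.

Definition lebesgue_prod : set S -> \bar R := (@lebesgue_cV R n \x @lebesgue_cV R d)%E.

HB.instance Definition _ := Measure.on lebesgue_prod.

Lemma lebesgue_prod_rect (r s : R) : 0 <= r -> 0 <= s ->
  lebesgue_prod (cube r `*` cube s) = ((2 * r) ^+ n * (2 * s) ^+ d)%:E.
Proof.
move=> r0 s0; apply: etrans (product_measure1E _ _ (measurable_cube _) (measurable_cube _)) _.
by rewrite EFinM; congr (_ * _)%E; exact: lebesgue_cV_cube.
Qed.

Lemma lebesgue_prod_sigma_finite : sigma_finite setT lebesgue_prod.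
Proof.
exists (fun k : nat => cube k%:R `*` cube k%:R) => [|k].
  apply/esym; rewrite -subTset => -[x y] _.
  have [i xi] := cube_cover x; have [j yj] := cube_cover y; exists (maxn i j) => //.
  by split; [apply: cube_sub xi|apply: cube_sub yj]; rewrite ler_nat leq_max leqnn// orbT.
split; first exact: measurableX (measurable_cube _) (measurable_cube _).
by rewrite lebesgue_prod_rect// ltry.
Qed.

HB.instance Definition _ :=
  Measure_isSigmaFinite.Build _ _ _ lebesgue_prod lebesgue_prod_sigma_finite.

End Product.
End LebesgueColumn.

(** * Linear change of variables up to a multiplicative factor *)

Section LinearChange.
Variables (R : realType) (n : nat).
Notation lam := (@lebesgue_cV R n).
Notation cV := (borel 'cV[R]_n).
Implicit Types (A B : 'M[R]_n) (F : 'cV[R]_n -> \bar R).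

Lemma measurable_add_cV : measurable_fun setT (fun p : cV * cV => p.1 + p.2 : cV).
Proof.
apply: measurable_fun_cV => i; under eq_fun do rewrite mxE.
by apply: measurable_funD; apply: (measurable_fun_comp (measurable_entry i)).
Qed.

Lemma measurable_opp_cV : measurable_fun setT (fun y : cV => - y : cV).
Proof.
apply: measurable_fun_cV => i; under eq_fun do rewrite mxE.
by apply: measurableT_comp => //; exact: measurable_entry.
Qed.

Lemma measurable_mulmx A : measurable_fun setT (fun y : cV => A *m y : cV).
Proof.
apply: measurable_fun_cV => i; under eq_fun do rewrite mxE.
apply: measurable_sum => j; apply: measurable_funM => //.
exact: measurable_entry.
Qed.

Lemma measurable_affine A (b : 'cV[R]_n) :
  measurable_fun setT (fun y : cV => A *m y + b : cV).
Proof.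
apply: measurable_fun_cV => i; under eq_fun do rewrite mxE.
apply: measurable_funD => //.
exact: (measurable_fun_comp (measurable_entry i) (measurable_mulmx A)).
Qed.

Lemma preserves_addl (b : 'cV[R]_n) : preserves lam (fun y => b + y).
Proof.
by rewrite (_ : (fun y => _) = +%R ^~ b)//; [exact: lebesgue_cV_shift|
  apply/funext => y; rewrite addrC].
Qed.

Local Open Scope ereal_scope.

(** The exchange identity for the additive group. With a cube indicator as [u] it shows that a
    linear map scales every integral by the same factor. *)
Lemma integral_mulmx_exchange A (F u : cV -> \bar R) : A \in unitmx ->
  measurable_fun setT F -> (forall x, 0 <= F x) ->
  measurable_fun setT u -> (forall x, 0 <= u x) ->
  \int[lam]_g F (A *m g) * \int[lam]_h u h =
  \int[lam]_g u (A *m g) * \int[lam]_h F (- h)%R.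
Proof.
move=> uA mF F0 mu_ u0.
apply: (@twisted_haar_unique _ cV R lam +%R -%R (mulmx A) (mulmx (invmx A))) => //.
- exact: measurable_add_cV.
- exact: measurable_opp_cV.
- exact: measurable_mulmx.
- by move=> x y; rewrite addrA addNr add0r.
- by move=> x y; rewrite opprD opprK addrC.
- by move=> h g; rewrite mulmxDr mulmxA mulmxV// mul1mx.
- exact: preserves_addl.
- exact: lebesgue_cV_shift.
Qed.

Let ind1 : cV -> \bar R := fun y => (\1_(@cube R n 1) y)%:E.

Let mind1 : measurable_fun setT ind1.
Proof. by apply/measurable_EFinP; apply: measurable_indic; exact: measurable_cube. Qed.

Let ind1_ge0 y : 0 <= ind1 y. Proof. by rewrite lee_fin. Qed.

Let int_ind1 : \int[lam]_y ind1 y = (2 ^+ n)%:E.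
Proof.
rewrite integral_indic ?setIT//; last exact: measurable_cube.
by apply: etrans (lebesgue_cV_cube n ler01) _; rewrite mulr1.
Qed.

Let muleI2n (a b : \bar R) : a * (2 ^+ n)%:E = b * (2 ^+ n)%:E -> a = b.
Proof.
move=> /(congr1 (fun z => z * ((2 ^+ n)^-1)%:E)).
by rewrite -!muleA -!EFinM divff ?expf_neq0// !mule1.
Qed.

Lemma lebesgue_cV_opp : preserves lam -%R.
Proof.
move=> F mF F0; apply: muleI2n; rewrite -int_ind1.
have := integral_mulmx_exchange (unitmx1 _ _) mF F0 mind1 ind1_ge0.
have E (f : cV -> \bar R) : (fun y => f (1%:M *m y)) = f.
  by apply/funext => y; rewrite mul1mx.
by rewrite !E => ->; rewrite muleC.
Qed.

(* [set y | cube 1 (invmx A *m y)] is the image of the cube [-1,1]^n under [A]. *)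
Definition jac A : R :=
  fine (lam [set y | @cube R n 1 (invmx A *m y)]) / 2 ^+ n.

(** The largest absolute row sum is the operator norm of [A] for the sup norm, whose unit ball is
    the cube. *)
Lemma cube_mulmx A r : (forall i, \sum_j `|A i j| <= r)%R ->
  A \in unitmx -> [set y | @cube R n 1 (invmx A *m y)] `<=` @cube R n r.
Proof.
move=> Ar uA y /= Ay i; rewrite -[y](mulKVmx uA) mxE.
apply: le_trans (ler_norm_sum _ _ _) _; apply: le_trans (Ar i).
apply: ler_sum => j _; rewrite normrM -[leRHS]mulr1.
by apply: ler_wpM2l => //; exact: Ay.
Qed.

Lemma measurable_preimage_cube A :
  measurable ([set y | @cube R n 1 (invmx A *m y)] : set cV).
Proof.
rewrite -[X in measurable X]setTI.
by apply: (measurable_mulmx (invmx A)) => //; exact: measurable_cube.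
Qed.

Lemma lebesgue_preimage_cube_le A r : (0 <= r)%R -> (forall i, \sum_j `|A i j| <= r)%R ->
  A \in unitmx -> lam [set y | @cube R n 1 (invmx A *m y)] <= ((2 * r) ^+ n)%:E.
Proof.
move=> r0 Ar uA; rewrite -lebesgue_cV_cube//; apply: le_measure.
- by apply/mem_set; exact: measurable_preimage_cube.
- by apply/mem_set; exact: measurable_cube.
- exact: cube_mulmx.
Qed.

Lemma jacE A : A \in unitmx ->
  lam [set y | @cube R n 1 (invmx A *m y)] = (jac A * 2 ^+ n)%:E.
Proof.
move=> uA; rewrite /jac divfK ?expf_neq0// fineK// ge0_fin_numE//.
apply: le_lt_trans (ltry _).
apply: (@lebesgue_preimage_cube_le _ (\sum_i \sum_j `|A i j|)%R) => // [|i].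
  by apply: sumr_ge0 => i _; exact: sumr_ge0.
rewrite [leRHS](bigD1 i)//= lerDl; apply: sumr_ge0 => k _; exact: sumr_ge0.
Qed.

Lemma jac_le A r : (0 <= r)%R -> (forall i, \sum_j `|A i j| <= r)%R ->
  A \in unitmx -> (jac A <= r ^+ n)%R.
Proof.
move=> r0 Ar uA; have := lebesgue_preimage_cube_le r0 Ar uA.
by rewrite jacE// lee_fin exprMn mulrC ler_pM2l// exprn_gt0.
Qed.

(** The exchange identity against [ind1] expresses the factor through the volume of the image of a
    single cube; the reflection left on the other side disappears by [lebesgue_cV_opp]. *)
Lemma integral_jac A (F : cV -> \bar R) : A \in unitmx ->
  measurable_fun setT F -> (forall x, 0 <= F x) ->
  \int[lam]_y F (invmx A *m y) = (jac A)%:E * \int[lam]_y F y.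
Proof.
move=> uA mF F0; apply: muleI2n; rewrite -{1}int_ind1.
rewrite integral_mulmx_exchange// ?unitmx_inv//.
rewrite (lebesgue_cV_opp mF F0) muleAC; congr (_ * _).
rewrite -EFinM -jacE// -[LHS]/(\int[lam]_y (\1_([set y | @cube R n 1 (invmx A *m y)]) y)%:E).
by rewrite integral_indic ?setIT//; exact: measurable_preimage_cube.
Qed.

Lemma jacM A B : A \in unitmx -> B \in unitmx -> jac (A *m B) = (jac A * jac B)%R.
Proof.
move=> uA uB.
have uAB : A *m B \in unitmx by rewrite unitmx_mul uA.
have mA C : measurable_fun setT (fun y : cV => ind1 (invmx C *m y)).
  by apply: (measurable_fun_comp mind1); exact: measurable_mulmx.
have := integral_jac uAB mind1 ind1_ge0.
have invAB : invmx (A *m B) = invmx B *m invmx A.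
  by apply: (can_inj (mulKmx uAB)); rewrite mulmxV// mulmxA mulmxK// mulmxV.
under eq_integral do rewrite invAB -mulmxA.
rewrite (integral_jac uA (mA B))//.
rewrite (integral_jac uB mind1)// muleA => /esym.
by rewrite int_ind1 => /muleI2n; rewrite -EFinM => -[].
Qed.

Lemma jac1 : jac 1%:M = 1%R.
Proof.
have := integral_jac (unitmx1 _ _) mind1 ind1_ge0.
under eq_integral do rewrite invmx1 mul1mx.
by rewrite -[LHS]mul1e int_ind1 => /muleI2n -[].
Qed.

Lemma jac_ge0 A : (0 <= jac A)%R.
Proof. by rewrite /jac divr_ge0// ?fine_ge0// exprn_ge0. Qed.

Lemma jac_diag (d : 'rV[R]_n) : (forall i, d 0%R i != 0%R) ->
  jac (diag_mx d) = (\prod_i `|d 0%R i|)%R.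
Proof.
move=> d0.
have ud : diag_mx d \in unitmx.
  by rewrite unitmxE det_diag unitfE; apply/prodf_neq0 => i _; exact: d0.
have := jacE ud.
rewrite (_ : [set y | _] = [set y : 'cV[R]_n | forall i, `|y i 0%R| <= `|d 0%R i|]%R).
  rewrite lebesgue_cV_rect// big_split/= prodr_const card_ord => -[].
  by rewrite mulrC => /(mulIf (expf_neq0 _ _)) ->//; rewrite pnatr_eq0.
have E (y : 'cV[R]_n) i : (y i 0 = d 0 i * (invmx (diag_mx d) *m y) i 0)%R.
  by rewrite -{1}[y](mulKVmx ud) mul_diag_mx mxE.
apply/seteqP; split=> y /= H i; have := H i.
  by rewrite (E y i) normrM ger_pMr// normr_gt0.
by rewrite (E y i) normrM ger_pMr// normr_gt0.
Qed.

End LinearChange.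

(** * The Jacobian factor is the absolute value of the determinant *)

Section Determinant.
Variable R : realType.

(** A crude binomial estimate, linear in [x], so that letting a parameter tend to zero becomes an
    explicit choice of that parameter. *)
Lemma expr1D_le (n : nat) (x : R) : 0 <= x <= 1 -> (1 + x) ^+ n <= 1 + 3 ^+ n * x.
Proof.
move=> /andP[x0 x1]; elim: n => [|n IH]; first by rewrite !expr0 mul1r lerDl.
rewrite exprSr; apply: (le_trans (ler_wpM2r _ IH)); first by lra.
have p1 : 1 <= 3 ^+ n :> R by rewrite exprn_ege1// ler1n.
have : 3 ^+ n * x * x <= 3 ^+ n * x :> R.
  by rewrite ler_piMr// mulr_ge0// (le_trans ler01).
have : x <= 3 ^+ n * x by rewrite ler_peMl.
rewrite exprS; move: (3 ^+ n) => c; lra.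
Qed.

Lemma jac_perm n (s : 'S_n) : jac (perm_mx s : 'M[R]_n) <= 1.
Proof.
rewrite -[leRHS](expr1n _ n); apply: jac_le => //; last exact: unitmx_perm.
move=> i; rewrite (bigD1 (s i))//= big1 ?addr0 => [|j ji].
  by rewrite !mxE eqxx normr1.
by rewrite !mxE eq_sym (negbTE ji) normr0.
Qed.

(* Conjugation by the diagonal matrix with entries [s ^+ rk i] pushes [A] to
   the identity as [s] tends to [0], without changing [jac A]. *)
Lemma jac_unitriangular n (rk : 'I_n -> nat) (A : 'M[R]_n) : A \in unitmx ->
  (forall i j, (rk i <= rk j)%N -> A i j = (i == j)%:R) -> jac A <= 1.
Proof.
move=> uA Atri.
pose M : R := \sum_i \sum_j `|A i j|.
have M0 : 0 <= M by apply: sumr_ge0 => i _; exact: sumr_ge0.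
suff jacs (s : R) : 0 < s -> s <= 1 -> jac A <= (1 + s * M) ^+ n.
  rewrite leNgt; apply/negP => jA.
  (* The second bound gives [3 ^+ n * e <= (jac A - 1) / 2]. Taking [s = e / (1 + M)] then keeps
     [s <= 1] and [s * M <= e], so that [(1 + s * M) ^+ n] stays below [jac A]. *)
  pose e : R := Num.min 1 ((jac A - 1) / (2 * 3 ^+ n)).
  have p3 : 0 < 3 ^+ n :> R by rewrite exprn_gt0.
  have e0 : 0 < e by rewrite lt_min ltr01 divr_gt0 ?subr_gt0// mulr_gt0.
  have e1 : e <= 1 by rewrite /e ge_min lexx.
  have eJ : 3 ^+ n * e < jac A - 1.
    apply: (@le_lt_trans _ _ (3 ^+ n * ((jac A - 1) / (2 * 3 ^+ n)))).
      by rewrite ler_pM2l// /e ge_min lexx orbT.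
    rewrite (_ : _ * _ = (jac A - 1) / 2); first by lra.
    by field; rewrite gt_eqF.
  have M1 : 0 < 1 + M by lra.
  have s0 : 0 < e / (1 + M) by rewrite divr_gt0.
  have s1 : e / (1 + M) <= 1 by rewrite ler_pdivrMr// mul1r; lra.
  have sM : 0 <= e / (1 + M) * M <= e.
    apply/andP; split; first by apply: mulr_ge0 => //; exact: ltW.
    rewrite mulrAC ler_pdivrMr//; have := e0; nra.
  have /andP[sM0 sMe] := sM.
  have := jacs _ s0 s1.
  have /(@expr1D_le n) : 0 <= e / (1 + M) * M <= 1 by rewrite sM0 (le_trans sMe).
  have : 3 ^+ n * (e / (1 + M) * M) <= 3 ^+ n * e by rewrite ler_pM2l.
  lra.
move=> s0 s1.
pose D := diag_mx (\row_i s ^+ rk i) : 'M[R]_n.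
have uD : D \in unitmx.
  rewrite unitmxE det_diag unitfE; apply/prodf_neq0 => i _.
  by rewrite mxE expf_neq0// gt_eqF.
have invD : invmx D = diag_mx (\row_i (s ^+ rk i)^-1).
  apply: (can_inj (mulKmx uD)); rewrite mulmxV// mulmx_diag.
  apply/matrixP => i j; rewrite !mxE; case: eqP => [->|]//=.
  by rewrite !mulr1n divff// expf_neq0// gt_eqF.
have -> : jac A = jac (D *m A *m invmx D).
  have uDi : invmx D \in unitmx by rewrite unitmx_inv.
  rewrite jacM ?unitmx_mul ?uD// jacM// mulrAC -jacM// mulmxV//.
  by rewrite jac1 mul1r.
apply: jac_le; last by rewrite !unitmx_mul uD uA unitmx_inv.
  by rewrite addr_ge0// mulr_ge0// ltW.
move=> i; rewrite (bigD1 i)//=.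
have E k j : (D *m A *m invmx D) k j = s ^+ rk k * A k j / s ^+ rk j.
  by rewrite invD mul_mx_diag mxE mul_diag_mx !mxE.
apply: lerD.
  by rewrite E Atri// eqxx mulr1 divff ?normr1// expf_neq0// gt_eqF.
apply: (@le_trans _ _ (s * \sum_j `|A i j|)); last first.
  rewrite ler_pM2l// /M [leRHS](bigD1 i)//= lerDl.
  by apply: sumr_ge0 => k _; exact: sumr_ge0.
rewrite [leRHS](_ : _ = s * `|A i i| + s * \sum_(j | j != i) `|A i j|); last first.
  by rewrite (bigD1 i)//= mulrDr.
rewrite -[leLHS]add0r; apply: lerD.
  by rewrite mulr_ge0// ltW.
rewrite mulr_sumr; apply: ler_sum => j ji; rewrite E.
(* Conjugation multiplies the entry by [s ^+ (rk i - rk j)] when [rk j < rk i]; the exponent is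
   positive, so the factor is at most [s]. All other off-diagonal entries vanish. *)
have [ij|ij] := leqP (rk i) (rk j).
  rewrite Atri// eq_sym (negbTE ji) mulr0 mul0r normr0.
  by rewrite mulr_ge0// ltW.
rewrite -(subnK (ltnW ij)) exprD mulrAC mulfK ?expf_neq0 ?gt_eqF//.
rewrite normrM (ger0_norm (exprn_ge0 _ (ltW s0))); apply: ler_wpM2r => //.
rewrite -[leRHS]expr1; apply: ler_wiXn2l => //; first exact: ltW.
by rewrite subn_gt0.
Qed.

(** In the LUP decomposition the permutation and both unitriangular factors have [jac] at most one,
    while the diagonal taken out of [U] carries the absolute value of the whole determinant. *)
Lemma jac_le_det n (A : 'M[R]_n) : A \in unitmx -> jac A <= `|\det A|.
Proof.
case: n A => [A uA|n A uA].
  by rewrite det_mx00 normr1 (flatmx0 A) -(flatmx0 1%:M) jac1.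
have := cormen_lup_correct A; have := cormen_lup_perm A.
have := @cormen_lup_lower R n A; have := @cormen_lup_upper R n A.
have := cormen_lup_detL A.
case: (cormen_lup A) => [[P L] U] /= dL Uup Llow /is_perm_mxP[s Ps] PA.
have uP : P \in unitmx by rewrite Ps unitmx_perm.
have uL : L \in unitmx by rewrite unitmxE dL unitr1.
have dU : \det U = \prod_i U i i.
  rewrite -det_tr det_trig; first by apply: eq_bigr => i _; rewrite mxE.
  by apply/is_trig_mxP => i j ij; rewrite mxE Uup.
have uU : U \in unitmx.
  by have : P *m A \in unitmx by [rewrite unitmx_mul uP]; rewrite [P *m A]PA unitmx_mul uL.
have U0 i : U i i != 0.
  by move: uU; rewrite unitmxE dU unitfE => /prodf_neq0; exact.
pose d : 'rV[R]_n.+1 := \row_i U i i.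
have d0 i : d 0 i != 0 by rewrite mxE.
pose U' := diag_mx (\row_i (U i i)^-1) *m U.
have UE : U = diag_mx d *m U'.
  rewrite mulmxA mulmx_diag (_ : diag_mx _ = 1%:M) ?mul1mx//.
  by apply/matrixP => i j; rewrite !mxE; case: eqP => //= ->; rewrite !mulr1n divff.
have ud : diag_mx d \in unitmx.
  by rewrite unitmxE det_diag unitfE; apply/prodf_neq0 => i _.
have uU' : U' \in unitmx by move: uU; rewrite UE unitmx_mul => /andP[].
have AE : A = perm_mx s^-1 *m (L *m (diag_mx d *m U')).
  by rewrite -UE -[L *m U]PA Ps mulmxA -perm_mxM mulVg perm_mx1 mul1mx.
have uDU : diag_mx d *m U' \in unitmx by rewrite -UE.
have uLDU : L *m (diag_mx d *m U') \in unitmx by rewrite unitmx_mul uL.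
rewrite {1}AE (jacM (unitmx_perm _ _) uLDU) (jacM uL uDU) (jacM ud uU').
have -> : `|\det A| = 1 * (1 * (jac (diag_mx d) * 1)).
  have dA : \det A = (-1) ^+ (s^-1)%g * \prod_i U i i.
    by rewrite {1}AE -UE !det_mulmx det_perm dL mul1r dU.
  rewrite !mul1r mulr1 jac_diag// dA normrM normrX normrN1 expr1n mul1r normr_prod.
  by apply: eq_bigr => i _; rewrite mxE.
have jge0 k (B : 'M[R]_k) := jac_ge0 B.
apply: ler_pM; [exact: jge0|exact: mulr_ge0 (jge0 _ _) (mulr_ge0 (jge0 _ _) (jge0 _ _))|exact: jac_perm|].
apply: ler_pM; [exact: jge0|exact: mulr_ge0 (jge0 _ _) (jge0 _ _)| |].
  by apply: (jac_unitriangular (rk := @nat_of_ord _) uL) => i j; exact: Llow.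
apply: ler_pM; rewrite ?jge0//.
(* For the upper triangular factor the ranking of the indices is reversed; the subtraction never
   truncates, since the matrix has size [n.+1]. *)
apply: (jac_unitriangular (rk := fun i => (n - i)%N) uU') => i j ij.
rewrite /U' mul_diag_mx !mxE.
have [->|nij] := eqVneq i j; first by rewrite mulVf.
rewrite (Uup i j); first by rewrite mulr0.
by rewrite ltn_neqAle eq_sym nij -(@leq_sub2lE n) // -ltnS.
Qed.

(** The upper bound applied to [invmx A] is the lower bound for [A], since both sides are
    multiplicative. *)
Lemma jac_det n (A : 'M[R]_n) : A \in unitmx -> jac A = `|\det A|.
Proof.
move=> uA; apply/eqP; rewrite eq_le jac_le_det//=.
have uAi : invmx A \in unitmx by rewrite unitmx_inv.
have := jac_le_det uAi; rewrite det_inv normfV => h.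
have dA : 0 < `|\det A| by rewrite normr_gt0 -unitfE -unitmxE.
have jA : jac A * jac (invmx A) = 1 by rewrite -jacM// mulmxV// jac1.
rewrite -(ler_pM2r (_ : 0 < `|\det A|^-1)) ?invr_gt0// divff ?gt_eqF//.
by rewrite -jA ler_wpM2l// jac_ge0.
Qed.

Lemma integral_affine n (A : 'M[R]_n) (b : 'cV[R]_n) (F : borel 'cV[R]_n -> \bar R) :
  A \in unitmx -> measurable_fun setT F -> (forall x, (0 <= F x)%E) ->
  (\int[@lebesgue_cV R n]_y F (A *m y + b)%R =
   (`|\det A|^-1)%:E * \int[@lebesgue_cV R n]_y F y)%E.
Proof.
move=> uA mF F0.
have uAi : invmx A \in unitmx by rewrite unitmx_inv.
rewrite -normfV -det_inv -jac_det//.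
rewrite -(lebesgue_cV_shift b mF F0).
rewrite -(@integral_jac R n (invmx A) (fun y => F (y + b)))// ?invmxK//.
apply: (measurable_fun_comp mF).
by under eq_fun do rewrite -[X in X + b]mul1mx; exact: measurable_affine.
Qed.

End Determinant.

(** * Haar measure of a translation complete subgroup *)

Section GroupCoordinates.
Variables (R : realType) (n : nat) (G : tcSubgroup R n).
Local Notation T := (tcType G).

Definition tc_index : finType :=
  ((((unit + unit) + ('I_n * 'I_1)) + ('I_n * 'I_1)) + ('I_n * 'I_n))%type.

Definition tc_coord (i : tc_index) (g : T) : R :=
  match i with
  | inl (inl (inl (inl _))) => complex.Re (\val (aWH_z (\val g)))
  | inl (inl (inl (inr _))) => complex.Im (\val (aWH_z (\val g)))
  | inl (inl (inr ij)) => aWH_x (\val g) ij.1 ij.2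
  | inl (inr ij) => aWH_xi (\val g) ij.1 ij.2
  | inr ij => \val (aWH_h (\val g)) ij.1 ij.2
  end.

Lemma tc_coord_nbhs : coord_nbhs tc_coord.
Proof.
have circ := coord_nbhs_initial (f := @circle_coord R)
  (coord_nbhs_prod (@coord_nbhs_real R) (@coord_nbhs_real R)).
have gl := coord_nbhs_initial (f := \val : GL R n -> 'M[R]_n) (@coord_nbhs_mx R n n).
have aw := coord_nbhs_prod (coord_nbhs_prod (coord_nbhs_prod circ
  (@coord_nbhs_mx R n 1)) (@coord_nbhs_mx R n 1)) gl.
have := coord_nbhs_initial (f := \val : T -> aWH R n) aw.
move=> H t U /H[e e0 eU]; exists e => // s st; apply: eU => i.
Qed.

Lemma tc_val_continuous : continuous (\val : T -> aWH R n).
Proof. exact: (@initial_continuous T _ (\val : T -> aWH R n)). Qed.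

Lemma tc_z_continuous : continuous (fun g : T => aWH_z (\val g)).
Proof. exact: (continuous_comp_fun tc_val_continuous (@aWH_z_continuous R n)). Qed.

Lemma tc_x_continuous : continuous (fun g : T => aWH_x (\val g)).
Proof. exact: (continuous_comp_fun tc_val_continuous (@aWH_x_continuous R n)). Qed.

Lemma tc_xi_continuous : continuous (fun g : T => aWH_xi (\val g)).
Proof. exact: (continuous_comp_fun tc_val_continuous (@aWH_xi_continuous R n)). Qed.

Lemma tc_h_continuous : continuous (fun g : T => aWH_h (\val g)).
Proof. exact: (continuous_comp_fun tc_val_continuous (@aWH_h_continuous R n)). Qed.

Lemma tc_coord_continuous i : continuous (tc_coord i).
Proof.
case: i => [[[[?|?]|[i j]]|[i j]]|[i j]] /=.
- exact: (continuous_comp_fun tc_z_continuous (@circle_re_continuous R)).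
- exact: (continuous_comp_fun tc_z_continuous (@circle_im_continuous R)).
- exact: (continuous_entry (i := i) (j := j) tc_x_continuous).
- exact: (continuous_entry (i := i) (j := j) tc_xi_continuous).
- exact: (continuous_entry (i := i) (j := j)
    (continuous_comp_fun tc_h_continuous (@GL_val_continuous R n))).
Qed.

Lemma tc_coord_inj (g h : T) : (forall i, tc_coord i g = tc_coord i h) -> g = h.
Proof.
move=> gh; apply: val_inj.
have := gh (inl (inl (inl (inl tt)))); have := gh (inl (inl (inl (inr tt)))).
have := fun ij => gh (inl (inl (inr ij))); have := fun ij => gh (inl (inr ij)).
have := fun ij => gh (inr ij).
rewrite /tc_coord; case: (\val g) => [[[z1 x1] xi1] h1]; case: (\val h) => [[[z2 x2] xi2] h2].
rewrite /aWH_z /aWH_x /aWH_xi /aWH_h /= => eh exi ex eim ere.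
congr (_, _, _, _).
- apply: val_inj; move: ere eim; case: z1 => -[a b] ?; case: z2 => -[a' b'] ? /=.
  by move=> -> ->.
- by apply/matrixP => i j; exact: (ex (i, j)).
- by apply/matrixP => i j; exact: (exi (i, j)).
- by apply: val_inj; apply/matrixP => i j; exact: (eh (i, j)).
Qed.

Lemma to_tc_continuous (X : topologicalType) (f : X -> T) :
  continuous (fun x => \val (f x)) -> continuous f.
Proof. exact: (@continuous_comp_initial _ _ _ (\val : T -> aWH R n) f). Qed.

Lemma measurable_tc_mul :
  measurable_fun setT (fun p : borel T * borel T => (p.1 * p.2)%g : borel T).
Proof.
exact: (measurable_continuous2 tc_coord_nbhs tc_coord_nbhs tc_coord_continuous
  tc_coord_continuous (@mulg_continuous T)).
Qed.

Lemma measurable_tc_inv : measurable_fun setT (fun g : borel T => (g^-1)%g : borel T).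
Proof. exact: (measurable_continuous (@invg_continuous T)). Qed.

Lemma measurable_tc_mull (h : T) :
  measurable_fun setT (fun g : borel T => (h * g)%g : borel T).
Proof.
exact: (measurable_fun_comp (f := fun g : borel T => (h : borel T, g))
  measurable_tc_mul (pair1_measurable _)).
Qed.

Lemma measurable_tc_mulr (h : T) :
  measurable_fun setT (fun g : borel T => (g * h)%g : borel T).
Proof.
exact: (measurable_fun_comp (f := fun g : borel T => (g, h : borel T))
  measurable_tc_mul (pair2_measurable _)).
Qed.

Lemma measurable_tc_set1 (g : T) : measurable ([set g] : set (borel T)).
Proof.
rewrite (_ : [set g] = \bigcap_(i in [set: tc_index]) tc_coord i @^-1` [set tc_coord i g]).
  apply: fin_bigcap_measurable => // i _; rewrite -[X in measurable X]setTI.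
  by apply: (measurable_continuous_real (@tc_coord_continuous i)) => //.
apply/seteqP; split=> [_ -> i _//|h hg]; apply: tc_coord_inj => i; exact: (hg i).
Qed.

Variable mu : {measure set (borel T) -> \bar R}.

Lemma left_invariant_preserves : left_invariant mu ->
  forall h : T, preserves mu (fun g : borel T => (h * g)%g : borel T).
Proof.
move=> li h; apply: preserves_measure => [|A mA].
  exact: measurable_tc_mull.
rewrite -[RHS](li h^-1%g)//; congr (mu _); apply/seteqP; split=> g /=.
  by move=> Ag; exists (h * g)%g; rewrite ?mulKg.
by move=> [k Ak <-]; rewrite mulKVg.
Qed.

Lemma right_invariant_preserves : right_invariant mu ->
  forall h : T, preserves mu (fun g : borel T => (g * h)%g : borel T).
Proof.
move=> ri h; apply: preserves_measure => [|A mA].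
  exact: measurable_tc_mulr.
rewrite -[RHS](ri h^-1%g)//; congr (mu _); apply/seteqP; split=> g /=.
  by move=> Ag; exists (g * h)%g; rewrite ?mulgK.
by move=> [k Ak <-]; rewrite mulgKV.
Qed.

(* Outer regularity at the identity gives an open neighbourhood of finite measure,
   and countably many rational boxes inside its translates cover the group. *)
Lemma haar_sigma_finite : left_haar mu -> sigma_finite setT mu.
Proof.
move=> [[fincompact outer _] _ li].
have [U [oU U1 Uoo]] : exists U : set T, [/\ open U, U 1%g & (mu U < +oo)%E].
  have := fincompact [set 1%g] (@compact_set1 _ _).
  rewrite (outer _ (measurable_tc_set1 1%g)) => /ereal_inf_lt[_ [U [oU U1] <-] Uoo].
  by exists U; split => //; exact: U1.
have mU : measurable (U : set (borel T)) by exact: sub_sigma_algebra.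
pose N (t : T) : set T := [set (t * u)%g | u in U].
have nN t : nbhs t (N t).
  have -> : N t = (fun s => t^-1 * s)%g @^-1` U.
    apply/seteqP; split=> [_ [u Uu <-] /=|s /= Us]; first by rewrite mulKg.
    by exists (t^-1 * s)%g => //; rewrite mulKVg.
  apply: open_nbhs_nbhs; split; last by rewrite /= mulVg.
  have c : continuous (fun s : T => (t^-1 * s)%g).
    apply: (continuous_comp_fun (continuous_pairing _ _) (@mulg_continuous T)).
      exact: cst_continuous.
    by move=> x; exact: cvg_id.
  by move/continuousP : c; exact.
(* A box inside a translate of [U] has measure at most [mu U] by left invariance; boxes that fit in
   no translate are replaced by the empty set. *)
pose P (p : {ffun tc_index -> rat * rat}) := `[< exists t, rat_box tc_coord p `<=` N t >].
pose F k : set (borel T) := if unpickle k is Some p then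
  (if P p then rat_box tc_coord p else set0) else set0.
have mbox p : measurable (rat_box tc_coord p : set (borel T)).
  apply: (measurable_rat_box (f := id : borel T -> T)) => i.
  exact: (@measurable_continuous_real R T (tc_coord i) (@tc_coord_continuous i)).
exists F => [|k].
  apply/esym; rewrite -subTset => t _.
  have [p [pt pN]] := coord_nbhs_rat_box tc_coord_nbhs (nN t).
  exists (pickle p) => //; rewrite /F pickleK /P; case: asboolP => // -[].
  by exists t.
rewrite /F; case: unpickle => [p|]; last by rewrite measure0 ltry.
rewrite /P; case: asboolP => [[t tN]|_]; last by rewrite measure0 ltry.
split=> //; apply: le_lt_trans Uoo; rewrite -(li t U mU).
apply: le_measure => //; apply/mem_set; first exact: mbox.
have := nN t => _; rewrite -/(N t).
have -> : N t = (fun s => t^-1 * s)%g @^-1` U.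
  apply/seteqP; split=> [_ [u Uu <-] /=|s /= Us]; first by rewrite mulKg.
  by exists (t^-1 * s)%g => //; rewrite mulKVg.
rewrite -[X in measurable X]setTI.
by apply: (measurable_tc_mull t^-1%g) => //.
Qed.

End GroupCoordinates.

(** * Linear coordinates on the frequency subspace *)

Section SubspaceCoordinates.
Variables (R : realType) (n : nat) (V : {vspace 'cV[R]_n}).

(** These matrices identify [V] with column vectors of length [\dim V], which brings Lebesgue
    measure to [V]. The map [vs_out] is defined on all vectors but inverts [vs_in] only on [V]. *)
Definition vs_in : 'M[R]_(n, \dim V) := \matrix_(i, j) (vbasis V)`_j i 0.

Definition vs_out : 'M[R]_(\dim V, n) :=
  \matrix_(i, j) coord (vbasis V) i (delta_mx j 0).

Lemma vs_inE (c : 'cV[R]_(\dim V)) : vs_in *m c = \sum_i c i 0 *: (vbasis V)`_i.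
Proof.
apply/matrixP => i j; rewrite (ord1 j) !mxE summxE; apply: eq_bigr => k _.
by rewrite !mxE mulrC.
Qed.

Lemma vs_outE (v : 'cV[R]_n) i : (vs_out *m v) i 0 = coord (vbasis V) i v.
Proof.
rewrite [v in RHS]matrix_sum_delta linear_sum mxE; apply: eq_bigr => j _.
by rewrite big_ord1 linearZ/= mxE mulrC.
Qed.

Lemma vs_in_mem (c : 'cV[R]_(\dim V)) : vs_in *m c \in V.
Proof.
rewrite vs_inE; apply: memv_suml => i _; apply: memvZ.
by apply/vbasis_mem/mem_nth; rewrite size_tuple.
Qed.

Lemma vs_inK (c : 'cV[R]_(\dim V)) : vs_out *m (vs_in *m c) = c.
Proof.
apply/matrixP => i j; rewrite (ord1 j) vs_outE vs_inE coord_sum_free//.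
exact: basis_free (vbasisP V).
Qed.

Lemma vs_outK (v : 'cV[R]_n) : v \in V -> vs_in *m (vs_out *m v) = v.
Proof.
move=> vV; rewrite vs_inE [RHS](coord_vbasis vV).
by apply: eq_bigr => i _; rewrite vs_outE.
Qed.

Lemma dimv_lt : V != fullv -> (\dim V < n)%N.
Proof.
apply: contraR; rewrite -leqNgt => h; rewrite eqEdim subvf/= dimvf.
by rewrite /dim/= muln1.
Qed.

End SubspaceCoordinates.

Lemma preserves_prod d1 d2 (X : measurableType d1) (Y : measurableType d2) (R : realType)
    (m1 : {sigma_finite_measure set X -> \bar R})
    (m2 : {sigma_finite_measure set Y -> \bar R}) (f : X -> X) (g : Y -> Y) :
  measurable_fun setT f -> measurable_fun setT g ->
  preserves m1 f -> preserves m2 g ->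
  preserves (m1 \x m2)%E (fun p => (f p.1, g p.2)).
Proof.
move=> mf mg pf pg F mF F0.
have mFfg : measurable_fun setT (fun p : X * Y => F (f p.1, g p.2)).
  apply: (measurable_fun_comp mF); apply: measurable_fun_pair.
    exact: (measurable_fun_comp mf).
  exact: (measurable_fun_comp mg).
rewrite (fubini_tonelli1 (fun p => F (f p.1, g p.2)))// (fubini_tonelli1 F)//.
rewrite -[RHS]pf; last 2 first.
- exact: measurable_fun_fubini_tonelli_F.
- by move=> x; exact: integral_ge0.
apply: eq_integral => x _; rewrite /fubini_F/=.
rewrite -(pg (fun y => F (f x, y)))//.
exact: (measurable_fun_comp mF (pair1_measurable _)).
Qed.

Lemma dotvZl (R : realType) n (a : R) (x y : 'cV[R]_n) : dotv (a *: x) y = a * dotv x y.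
Proof. by rewrite !dotvE linearZ/= -scalemxAl mxE. Qed.

Lemma dotvZr (R : realType) n (a : R) (x y : 'cV[R]_n) : dotv x (a *: y) = a * dotv x y.
Proof. by rewrite !dotvE -scalemxAr mxE. Qed.

Lemma mule_cancel (R : realType) (k c : R) (x y : \bar R) : k != 0 ->
  (k%:E * x = (k * c)%:E * y -> x = c%:E * y)%E.
Proof.
move=> k0; rewrite EFinM -muleA => /(congr1 (mule k^-1%:E)).
by rewrite !(muleA k^-1%:E) -EFinM mulVf// !mul1e.
Qed.

(** * Scaling of Haar integrals under dilation *)

Section Modulus.
Variables (R : realType) (n : nat) (G : tcSubgroup R n).
Local Notation T := (tcType G).
Local Notation V := (tcV G).
Local Notation d := (\dim V).
Local Notation gx g := (aWH_x (\val (g : T))).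
Local Notation gxi g := (aWH_xi (\val (g : T))).
Local Notation gh g := (\val (aWH_h (\val (g : T)))).

Lemma tcP (g : T) : tcSet G (\val g). Proof. exact/set_mem/(valP g). Qed.

Lemma tc_eq (g h : T) : aWH_z (\val g) = aWH_z (\val h) -> gx g = gx h ->
  gxi g = gxi h -> aWH_h (\val g) = aWH_h (\val h) -> g = h.
Proof.
move=> + + + +; rewrite /aWH_z /aWH_x /aWH_xi /aWH_h => ez ex exi eh.
apply: val_inj; move: ez ex exi eh.
by case: (\val g) => [[[? ?] ?] ?]; case: (\val h) => [[[? ?] ?] ?] /= -> -> -> ->.
Qed.

Lemma tc_mulE (g h : T) : [/\
  aWH_z (\val (g * h)%g) =
    (aWH_z (\val g) * aWH_z (\val h) * e2pi (dotv (gxi g) (gh g *m gx h)))%g,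
  gx (g * h)%g = gx g + gh g *m gx h,
  gxi (g * h)%g = gxi g + (invmx (gh g))^T *m gxi h &
  aWH_h (\val (g * h)%g) = (aWH_h (\val g) * aWH_h (\val h))%g].
Proof.
have -> : \val (g * h)%g = (\val g * \val h)%g by [].
by case: (\val g) => [[[? ?] ?] ?]; case: (\val h) => [[[? ?] ?] ?].
Qed.

Lemma tc_invE (g : T) : [/\
  aWH_z (\val g^-1%g) = ((aWH_z (\val g))^-1 * e2pi (dotv (gxi g) (gx g)))%g,
  gx g^-1%g = - (invmx (gh g) *m gx g),
  gxi g^-1%g = - ((gh g)^T *m gxi g) &
  aWH_h (\val g^-1%g) = (aWH_h (\val g))^-1%g].
Proof.
have -> : \val g^-1%g = (\val g)^-1%g by [].
by case: (\val g) => [[[? ?] ?] ?].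
Qed.

Lemma dilate_subproof (a : R) (g : T) :
  ((aWH_z (\val g), a^-1 *: gx g, a *: gxi g, aWH_h (\val g)) : aWH R n) \in tcSet G.
Proof. by apply/mem_set; have [? ?] := tcP g; split => //; exact: memvZ. Qed.

Definition dilate (a : R) (g : T) : T := exist (fun k : aWH R n => k \in tcSet G) _ (dilate_subproof a g).

Lemma dilateE a g : [/\ aWH_z (\val (dilate a g)) = aWH_z (\val g),
  gx (dilate a g) = a^-1 *: gx g, gxi (dilate a g) = a *: gxi g &
  aWH_h (\val (dilate a g)) = aWH_h (\val g)].
Proof. by []. Qed.

(** The phase of the product is unchanged because the factors [a] and [a^-1] cancel in the pairing
    of frequency with position. *)
Lemma dilateM a (g h : T) : a != 0 ->
  dilate a (g * h)%g = (dilate a g * dilate a h)%g.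
Proof.
move=> a0; have [ez ex exi eh] := tc_mulE g h.
have [ez' ex' exi' eh'] := tc_mulE (dilate a g) (dilate a h).
have [dz dx dxi dh] := dilateE a (g * h)%g.
have [dz1 dx1 dxi1 dh1] := dilateE a g; have [dz2 dx2 dxi2 dh2] := dilateE a h.
apply: tc_eq.
- rewrite dz ez ez' dz1 dz2 dxi1 dx2 dh1 -scalemxAr dotvZl dotvZr mulrA.
  by rewrite mulfV// mul1r.
- by rewrite dx ex ex' dx1 dx2 dh1 scalerDr -scalemxAr.
- by rewrite dxi exi exi' dxi1 dxi2 dh1 scalerDr -scalemxAr.
- by rewrite dh eh eh' dh1 dh2.
Qed.

Lemma dilateVK a : a != 0 -> cancel (dilate a^-1) (dilate a).
Proof.
move=> a0 g; have [dz dx dxi dh] := dilateE a (dilate a^-1 g).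
have [dz1 dx1 dxi1 dh1] := dilateE a^-1 g.
apply: tc_eq; rewrite ?dz ?dh// ?dx ?dxi ?dx1 ?dxi1 scalerA ?invrK.
  by rewrite mulVf// scale1r.
by rewrite mulfV// scale1r.
Qed.

Lemma dilate_continuous a : continuous (dilate a).
Proof.
have cs m (k : R) (f : T -> 'cV[R]_m) : continuous f -> continuous (fun g => k *: f g).
  move=> cf; rewrite (_ : (fun g => _) = (fun g => k%:M *m f g)).
    by apply: continuous_mulmx => //; exact: cst_continuous.
  by apply/funext => g; rewrite mul_scalar_mx.
apply: to_tc_continuous; apply: to_aWH_continuous => /=.
- exact: tc_z_continuous.
- by apply: cs; exact: tc_x_continuous.
- by apply: cs; exact: tc_xi_continuous.
- exact: tc_h_continuous.
Qed.

Lemma measurable_dilate a : measurable_fun setT (dilate a : borel T -> borel T).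
Proof. exact: (measurable_continuous (@dilate_continuous a)). Qed.

Lemma shift_x_subproof (x : 'cV[R]_n) : ((1%g, x, 0, 1%g) : aWH R n) \in tcSet G.
Proof. by apply/mem_set; split; [exact: mem0v|exact: tcH1]. Qed.

Definition shift_x x : T := exist (fun k : aWH R n => k \in tcSet G) _ (shift_x_subproof x).

Lemma shift_xi_subproof (c : 'cV[R]_d) :
  ((1%g, 0, vs_in V *m c, 1%g) : aWH R n) \in tcSet G.
Proof. by apply/mem_set; split; [exact: vs_in_mem|exact: tcH1]. Qed.

Definition shift_xi c : T := exist (fun k : aWH R n => k \in tcSet G) _ (shift_xi_subproof c).

Local Notation S := (borel 'cV[R]_n * borel 'cV[R]_d)%type.

(** Positions are shifted from the left and frequencies from the right: on these sides the group law
    contributes no phase, so the pair acts as an additive group that fixes the circle and matrix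
    components. *)
Definition shift2 (t : S) (g : T) : T := (shift_x t.1 * g * shift_xi t.2)%g.

Lemma shift2E t g : [/\
  aWH_z (\val (shift2 t g)) = aWH_z (\val g),
  gx (shift2 t g) = t.1 + gx g,
  gxi (shift2 t g) = gxi g + (invmx (gh g))^T *m (vs_in V *m t.2) &
  aWH_h (\val (shift2 t g)) = aWH_h (\val g)].
Proof.
have [ez ex exi eh] := tc_mulE (shift_x t.1) g.
have [ez' ex' exi' eh'] := tc_mulE (shift_x t.1 * g)%g (shift_xi t.2).
have sx : [/\ aWH_z (\val (shift_x t.1)) = 1%g, gx (shift_x t.1) = t.1,
  gxi (shift_x t.1) = 0 & aWH_h (\val (shift_x t.1)) = 1%g] by [].
have sxi : [/\ aWH_z (\val (shift_xi t.2)) = 1%g, gx (shift_xi t.2) = 0,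
  gxi (shift_xi t.2) = vs_in V *m t.2 & aWH_h (\val (shift_xi t.2)) = 1%g] by [].
have [z1 x1 xi1 h1] := sx; have [z2 x2 xi2 h2] := sxi.
rewrite /shift2 ez' ex' exi' eh' ez ex exi eh z1 x1 xi1 h1 z2 x2 xi2 h2.
have -> : \val (1 : GL R n)%g = 1%:M by [].
rewrite dotv0l mulmx0 dotv0r e2pi0 !mulg1 !mul1g mul1mx invmx1 trmx1 mul1mx add0r addr0.
by split.
Qed.

(** Right translation by a frequency arrives twisted by the inverse transpose of the matrix
    component. The factor [(gh g)^T] undoes the twist, so [shift2] acts on these coordinates by
    plain addition. *)
Definition shift_coord (g : T) : S := (gx g, vs_out V *m ((gh g)^T *m gxi g)).

Definition subS (s t : S) : S := (s.1 - t.1, s.2 - t.2).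

Lemma shift_coord_shift2 t g : subS (shift_coord (shift2 t g)) t = shift_coord g.
Proof.
have [_ ex exi eh] := shift2E t g.
rewrite /subS /shift_coord ex exi eh /=; congr (_, _); first by rewrite addrAC subrr add0r.
rewrite mulmxDr (mulmxA _ (invmx _)^T) -trmx_mul mulVmx ?(valP (aWH_h _))// trmx1 mul1mx.
by rewrite mulmxDr vs_inK addrK.
Qed.

Lemma shift2D s t g : shift2 t (shift2 s g) = shift2 (t.1 + s.1, t.2 + s.2) g.
Proof.
have [ez ex exi eh] := shift2E t (shift2 s g).
have [ez' ex' exi' eh'] := shift2E s g.
have [ez2 ex2 exi2 eh2] := shift2E (t.1 + s.1, t.2 + s.2) g.
apply: tc_eq.
- by rewrite ez ez' ez2.
- by rewrite ex ex' ex2 addrA.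
- by rewrite exi exi' exi2 eh' /= !mulmxDr -addrA [in LHS](addrC (_ *m _)).
- by rewrite eh eh' eh2.
Qed.

Lemma stableV (g : T) : (gh g)^T *m gxi g \in V.
Proof. by have [? ?] := tcP g; exact: tcV_stable. Qed.

(** A dilation changes neither the circle nor the matrix component, so it moves [g] within its orbit
    under shifts. The required shift depends on [g], which is harmless for functions constant along
    orbits. *)
Lemma dilate_shift2 a g :
  dilate a g = shift2 (subS (shift_coord (dilate a g)) (shift_coord g)) g.
Proof.
have [ez ex exi eh] := shift2E (subS (shift_coord (dilate a g)) (shift_coord g)) g.
apply: tc_eq; rewrite ?ez ?ex ?exi ?eh//.
  by rewrite /= subrK.
have hg : gh (dilate a g) = gh g by [].
rewrite /= !mulmxBr !vs_outK ?stableV//; last first.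
  by rewrite -[X in X *m _]/((gh (dilate a g))^T); exact: stableV.
rewrite hg !mulmxA -trmx_mul mulmxV ?(valP (aWH_h _))// trmx1 !mul1mx.
by rewrite addrC subrK.
Qed.

Lemma measurable_subS : measurable_fun setT (fun p : S * S => subS p.1 p.2).
Proof.
apply: measurable_fun_pair; apply: measurable_fun_cV => i; under eq_fun do rewrite !mxE;
  apply: measurable_funB; apply: (measurable_fun_comp (measurable_entry i)).
- exact: (measurable_fun_comp measurable_fst measurable_fst).
- exact: (measurable_fun_comp measurable_fst measurable_snd).
- exact: (measurable_fun_comp measurable_snd measurable_fst).
- exact: (measurable_fun_comp measurable_snd measurable_snd).
Qed.

Lemma shift_x_continuous : continuous shift_x.
Proof.
apply: to_tc_continuous; apply: to_aWH_continuous => /=; try exact: cst_continuous.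
by move=> x; exact: cvg_id.
Qed.

Lemma shift_xi_continuous : continuous shift_xi.
Proof.
apply: to_tc_continuous; apply: to_aWH_continuous => /=; try exact: cst_continuous.
apply: continuous_mulmx; first exact: cst_continuous.
by move=> x; exact: cvg_id.
Qed.

Lemma measurable_shift2 :
  measurable_fun setT (fun p : S * borel T => shift2 p.1 p.2 : borel T).
Proof.
apply: (measurable_fun_comp (@measurable_tc_mul R n G) (f := fun p : S * borel T =>
  ((shift_x p.1.1 * p.2)%g : borel T, shift_xi p.1.2 : borel T))).
apply: measurable_fun_pair.
  apply: (measurable_fun_comp (@measurable_tc_mul R n G) (f := fun p : S * borel T =>
    (shift_x p.1.1 : borel T, p.2))).
  apply: measurable_fun_pair => //.
  apply: (measurable_fun_comp (measurable_continuous shift_x_continuous)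
    (f := fun p : S * borel T => p.1.1)).
  exact: (measurable_fun_comp measurable_fst).
apply: (measurable_fun_comp (measurable_continuous shift_xi_continuous)
  (f := fun p : S * borel T => p.1.2)).
exact: (measurable_fun_comp measurable_snd).
Qed.

Lemma measurable_shift_coord : measurable_fun setT (shift_coord : borel T -> S).
Proof.
apply: measurable_fun_pair.
  exact: (measurable_continuous (@tc_x_continuous R n G)).
apply: (@measurable_continuous T 'cV[R]_d).
apply: continuous_mulmx; first exact: cst_continuous.
apply: continuous_mulmx; last exact: tc_xi_continuous.
apply: continuous_trmx.
exact: (continuous_comp_fun (@tc_h_continuous R n G) (@GL_val_continuous R n)).
Qed.

Local Open Scope ereal_scope.

Local Notation lamS := (@lebesgue_prod R n d).

Lemma preserves_subS (s : S) : preserves lamS (subS s).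
Proof.
have ms m (b : 'cV[R]_m) : measurable_fun setT (fun y : borel 'cV[R]_m => b - y : borel 'cV[R]_m)%R.
  apply: measurable_fun_cV => i; under eq_fun do rewrite !mxE.
  by apply: measurable_funB => //; exact: measurable_entry.
have ps m (b : 'cV[R]_m) : preserves (@lebesgue_cV R m) (fun y => b - y)%R.
  move=> F mF F0; rewrite -[RHS](preserves_addl b)// -[RHS]lebesgue_cV_opp//.
  apply: (measurable_fun_comp mF).
  apply: measurable_fun_cV => i; under eq_fun do rewrite !mxE.
  by apply: measurable_funD => //; exact: measurable_entry.
exact: (preserves_prod (ms _ _) (ms _ _) (ps _ _) (ps _ _)).
Qed.

Lemma preserves_addS (s : S) : preserves lamS (fun t => (t.1 + s.1, t.2 + s.2)%R).
Proof.
have ms m (b : 'cV[R]_m) : measurable_fun setT (fun y : borel 'cV[R]_m => y + b : borel 'cV[R]_m)%R.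
  apply: measurable_fun_cV => i; under eq_fun do rewrite !mxE.
  by apply: measurable_funD => //; exact: measurable_entry.
exact: (preserves_prod (ms _ _) (ms _ _) (lebesgue_cV_shift _) (lebesgue_cV_shift _)).
Qed.

Variable mu : {sigma_finite_measure set (borel T) -> \bar R}.
Hypothesis mu0 : mu setT != 0.
Hypothesis mull : forall h : T, preserves mu (fun g : borel T => (h * g)%g : borel T).
Hypothesis mulr : forall h : T, preserves mu (fun g : borel T => (g * h)%g : borel T).

Lemma preserves_shift2 t : preserves mu (shift2 t).
Proof.
move=> F mF F0; rewrite -[RHS](mulr (shift_xi t.2))//.
rewrite -[RHS](mull (shift_x t.1))//.
exact: (measurable_fun_comp mF (measurable_tc_mulr _)).
Qed.

(** The average over an orbit does not depend on its starting point, by translation invariance of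
    [lamS]. *)
Lemma average_dilate (a : R) (w : borel T -> \bar R) (g : T) :
  measurable_fun setT w -> (forall x, 0 <= w x) ->
  @average _ _ (borel T) S R lamS shift2 w (dilate a g) = @average _ _ (borel T) S R lamS shift2 w g.
Proof.
move=> mw w0; rewrite /average dilate_shift2; set s := subS _ _.
rewrite -[RHS](preserves_addS s)//; last first.
  exact: (measurable_fun_comp mw (measurable_fun_comp measurable_shift2 (pair2_measurable _))).
by apply: eq_integral => t _; rewrite shift2D.
Qed.

(** Its indicator is a test function whose integral can be cancelled in the exchange and unfolding
    identities. *)
Lemma finite_nonnull_set : exists F : set (borel T),
  [/\ measurable F, mu F < +oo & mu F != 0].
Proof.
have [F FT mF] := sigma_finiteT mu.
apply: contrapT => /forallNP H; move/eqP: mu0; apply.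
have F0 k : mu (F k) = 0.
  apply: contrapT => /eqP Fk; have [mFk Fkoo] := mF k.
  by apply: (H (F k)).
apply/negligibleP => //; rewrite FT; apply: negligible_bigcup => k.
by apply/negligibleP; [have [] := mF k|exact: F0].
Qed.

Lemma twisted_dilate a (F u : borel T -> \bar R) : a != 0%R ->
  measurable_fun setT F -> (forall x, 0 <= F x) ->
  measurable_fun setT u -> (forall x, 0 <= u x) ->
  \int[mu]_g F (dilate a g) * \int[mu]_g u g =
  \int[mu]_g u (dilate a g) * \int[mu]_g F (g^-1)%g.
Proof.
move=> a0 mF F0 mu_ u0.
apply: (@twisted_haar_unique _ (borel T) R mu (fun g h => g * h)%g (fun g => g^-1)%g
  (dilate a) (dilate a^-1)) => //.
- exact: measurable_tc_mul.
- exact: measurable_tc_inv.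
- exact: measurable_dilate.
- exact: mulKg.
- by move=> x y; rewrite invMg invgK.
- by move=> h g; rewrite dilateM// dilateVK.
Qed.

Lemma dilate1 (g : T) : dilate 1 g = g.
Proof. by apply: tc_eq => //=; rewrite /aWH_x /aWH_xi /= ?invr1 scale1r. Qed.

(** The exchange identity with dilation factor one, where the automorphism is trivial. *)
Lemma integral_tc_inv (F : borel T -> \bar R) :
  measurable_fun setT F -> (forall x, 0 <= F x) ->
  \int[mu]_g F (g^-1)%g = \int[mu]_g F g.
Proof.
move=> mF F0; have [A [mA Aoo A0]] := finite_nonnull_set.
have mA1 : measurable_fun setT (fun g : borel T => (\1_A g)%:E : \bar R).
  by apply/measurable_EFinP; exact: measurable_indic.
have A10 (g : borel T) : 0 <= (\1_A g)%:E :> \bar R by rewrite lee_fin.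
have := twisted_dilate (oner_neq0 _) mF F0 mA1 A10.
under eq_integral do rewrite dilate1.
under [in X in _ = X * _ -> _]eq_integral do rewrite dilate1.
have fA : mu A \is a fin_num by rewrite ge0_fin_numE.
have fA0 : fine (mu A) != 0%R by rewrite fine_eq0.
have -> : \int[mu]_g (\1_A g)%:E = (fine (mu A))%:E.
  by rewrite integral_indic// setIT fineK.
rewrite muleC => /(congr1 (fun z => ((fine (mu A))^-1)%:E * z)).
by rewrite !muleA -!EFinM mulVf// !mul1e => ->.
Qed.

(* The average [W] of an indicator over all shifts is invariant under [dilate a],
   as [dilate a g] is a shift of [g]; hence the scaling factor can be read off
   from the product of [W] with a cube indicator in the shift coordinates. *)
Lemma integral_dilate a (F : borel T -> \bar R) : (0 < a)%R ->
  measurable_fun setT F -> (forall x, 0 <= F x) ->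
  \int[mu]_g F (dilate a g) = (a ^+ n / a ^+ d)%:E * \int[mu]_g F g.
Proof.
move=> a0 mF F0; have [A [mA Aoo A0]] := finite_nonnull_set.
have an0 : a != 0%R by rewrite gt_eqF.
have mA1 : measurable_fun setT (fun g : borel T => (\1_A g)%:E : \bar R).
  by apply/measurable_EFinP; exact: measurable_indic.
have A10 (g : borel T) : 0 <= (\1_A g)%:E :> \bar R by rewrite lee_fin.
have fA : mu A \is a fin_num by rewrite ge0_fin_numE.
have fA0 : fine (mu A) != 0%R by rewrite fine_eq0.
pose ind (r s : R) (p : S) : \bar R := (\1_(cube r `*` cube s) p)%:E.
have mind r s : measurable_fun setT (ind r s).
  apply/measurable_EFinP; apply: measurable_indic.
  exact: measurableX (measurable_cube _) (measurable_cube _).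
have ind0 r s p : 0 <= ind r s p by rewrite lee_fin.
have int_ind r s : (0 <= r)%R -> (0 <= s)%R -> \int[lamS]_p ind r s p =
    ((2 * r) ^+ n * (2 * s) ^+ d)%R%:E.
  move=> r0 s0; rewrite integral_indic ?setIT//.
    exact: lebesgue_prod_rect.
  exact: measurableX (measurable_cube _) (measurable_cube _).
(* A box in the shift coordinates leaves the matrix component free, so its preimage may have
   infinite measure. The weight [W] makes the integral finite and nonzero, namely the measure of [A]
   times the volume of the box. *)
pose W := @average _ _ (borel T) S R lamS shift2 (fun g => (\1_A g)%:E).
have mW : measurable_fun setT W by apply: measurable_average => //; exact: measurable_shift2.
have W0 g : 0 <= W g by exact: average_ge0.
pose u r s (g : borel T) : \bar R := ind r s (shift_coord g) * W g.
have mu_ r s : measurable_fun setT (u r s).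
  by apply: emeasurable_funM => //; exact: (measurable_fun_comp (mind r s) measurable_shift_coord).
have u0 r s g : 0 <= u r s g by rewrite mule_ge0.
have int_u r s : (0 <= r)%R -> (0 <= s)%R -> \int[mu]_g u r s g =
    (fine (mu A) * ((2 * r) ^+ n * (2 * s) ^+ d))%R%:E.
  move=> r0 s0; rewrite EFinM -int_ind//.
  have <- : \int[mu]_g (\1_A g)%:E = (fine (mu A))%:E.
    by rewrite integral_indic// setIT fineK.
  exact: (@integral_average _ _ (borel T) S R mu lamS shift2 shift_coord subS measurable_shift2
    measurable_shift_coord measurable_subS preserves_shift2 shift_coord_shift2
    preserves_subS _ _ mA1 A10 (mind r s) (ind0 r s)).
have ai0 : (0 <= a^-1)%R by rewrite invr_ge0 ltW.
(* Dilation multiplies position by [a^-1] and frequency by [a], so the unit box pulls back to the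
   box of radii [a] and [a^-1]; the ratio of their volumes is the scaling factor. *)
have u_dilate g : u 1%R 1%R (dilate a g) = u a a^-1%R g.
  rewrite /u /W average_dilate//; congr (_ * _); rewrite /ind !indicE; congr ((nat_of_bool _)%:R%R%:E).
  have -> : shift_coord (dilate a g) =
      (a^-1 *: (shift_coord g).1, a *: (shift_coord g).2)%R.
    by rewrite /shift_coord /= -!scalemxAr.
  apply/idP/idP => /set_mem[/= H1 H2]; apply/mem_set; split=> /= i.
  - by have := H1 i; rewrite mxE normrM (ger0_norm ai0) mulrC ler_pdivrMr// mul1r.
  - have := H2 i; rewrite mxE normrM (ger0_norm (ltW a0)).
    by rewrite mulrC -ler_pdivlMr// mul1r.
  - by rewrite mxE normrM (ger0_norm ai0) mulrC ler_pdivrMr// mul1r; exact: H1.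
  - rewrite mxE normrM (ger0_norm (ltW a0)) mulrC -ler_pdivlMr// mul1r.
    exact: H2.
have := twisted_dilate an0 mF F0 (mu_ 1%R 1%R) (u0 1%R 1%R).
under [in X in _ = X * _ -> _]eq_integral do rewrite u_dilate.
rewrite integral_tc_inv// !int_u ?invr_ge0 ?(ltW a0)//.
set I := \int[mu]_g F g; set J := \int[mu]_g F _.
rewrite mulr1 muleC.
set k : R := (fine (mu A) * (2 ^+ n * 2 ^+ d))%R.
have k0 : k != 0%R by rewrite /k !mulf_neq0// expf_neq0// pnatr_eq0.
rewrite (_ : (fine (mu A) * _)%R = k * (a ^+ n / a ^+ d))%R; last first.
  rewrite /k !exprMn exprVn -!mulrA; congr (_ * (_ * _))%R.
  by rewrite mulrCA.
exact: mule_cancel.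
Qed.


End Modulus.

(** * Square integrable functions and the wavelet transform *)

Section Energy.
Variable R : realType.
Local Notation C := R[i].

Definition sqc (z : C) : R := complex.Re z ^+ 2 + complex.Im z ^+ 2.

Lemma sqc_ge0 z : 0 <= sqc z.
Proof. by rewrite addr_ge0// sqr_ge0. Qed.

Lemma sqcM z w : sqc (z * w) = sqc z * sqc w.
Proof. by case: z w => [a b] [c d]; rewrite /sqc /=; ring. Qed.

Lemma sqc_conj z : sqc z^*%C = sqc z.
Proof. by case: z => [a b]; rewrite /sqc /= sqrrN. Qed.

Lemma sqc_real (x : R) : sqc x%:C%C = x ^+ 2.
Proof. by rewrite /sqc /= expr0n addr0. Qed.

Lemma sqc0 : sqc 0 = 0. Proof. by rewrite /sqc /= expr0n addr0. Qed.

Lemma sqc_eq0 z : sqc z = 0 -> z = 0.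
Proof.
case: z => a b; rewrite /sqc /= => /eqP; rewrite paddr_eq0 ?sqr_ge0// !sqrf_eq0.
by move=> /andP[/eqP -> /eqP ->].
Qed.

Lemma normc_sqc (z : C) : Normc.normc z ^+ 2 = sqc z.
Proof. by case: z => a b; rewrite /= sqr_sqrtr// addr_ge0// sqr_ge0. Qed.

Lemma sqc_circle (z : circle R) : sqc (\val z) = 1.
Proof.
have := circle_norm z; rewrite normc_def => -[] h.
by rewrite /sqc -[LHS]sqr_sqrtr ?h ?expr1n// addr_ge0// sqr_ge0.
Qed.

Section Measure.
Context d (T : measurableType d) (mu : {measure set T -> \bar R}).
Implicit Types f g : T -> C.

(** The squared L^2 norm, kept as an integral of a nonnegative function so that the invariance
    statements apply to it directly. *)
Definition energy f : \bar R := \int[mu]_x (sqc (f x))%:E.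

Lemma energy_ge0 f : (0 <= energy f)%E.
Proof. by apply: integral_ge0 => x _; rewrite lee_fin sqc_ge0. Qed.

Lemma energyE f : (normL2 mu f `^ 2 = energy f)%E.
Proof.
rewrite /normL2 powR_Lnorm ?pnatr_eq0//; apply: eq_integral => x _.
have n0 : 0 <= Normc.normc (f x) by case: (f x) => a b; exact: sqrtr_ge0.
by rewrite gee0_abs ?lee_fin// poweR_EFin powR_mulrn// normc_sqc.
Qed.

Lemma inL2_energy f : inL2 mu f <-> cmeasurable f /\ (energy f < +oo)%E.
Proof.
split=> -[mf ff]; split => //; first by rewrite -energyE poweR_lty.
move: ff; rewrite -energyE => h; rewrite ltNge leye_eq; apply/eqP => E.
by move: h; rewrite E poweRyr ?pnatr_eq0// ltxx.
Qed.

Lemma measurable_sqc f : cmeasurable f -> measurable_fun setT (fun x => sqc (f x)).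
Proof.
by move=> [mr mi]; apply: measurable_funD; exact: measurable_funX.
Qed.

Lemma measurable_energy f : cmeasurable f ->
  measurable_fun setT (fun x => (sqc (f x))%:E : \bar R).
Proof. by move=> mf; apply/measurable_EFinP; exact: measurable_sqc. Qed.

Lemma cmeasurableM f g : cmeasurable f -> cmeasurable g ->
  cmeasurable (fun x => f x * g x).
Proof.
move=> [fr fi] [gr gi]; split.
  rewrite (_ : (fun x => _) = (fun x => complex.Re (f x) * complex.Re (g x) -
    complex.Im (f x) * complex.Im (g x))).
    by apply: measurable_funB; exact: measurable_funM.
  by apply/funext => x; case: (f x) => a b; case: (g x).
rewrite (_ : (fun x => _) = (fun x => complex.Re (f x) * complex.Im (g x) +
  complex.Im (f x) * complex.Re (g x))).
  by apply: measurable_funD; exact: measurable_funM.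
by apply/funext => x; case: (f x) => a b; case: (g x).
Qed.

Lemma cmeasurableB f g : cmeasurable f -> cmeasurable g ->
  cmeasurable (fun x => f x - g x).
Proof.
move=> [fr fi] [gr gi]; split.
  rewrite (_ : (fun x => _) = (fun x => complex.Re (f x) - complex.Re (g x))).
    exact: measurable_funB.
  by apply/funext => x; case: (f x) => a b; case: (g x).
rewrite (_ : (fun x => _) = (fun x => complex.Im (f x) - complex.Im (g x))).
  exact: measurable_funB.
by apply/funext => x; case: (f x) => a b; case: (g x).
Qed.

Lemma cmeasurable_conj f : cmeasurable f -> cmeasurable (fun x => (f x)^*%C).
Proof.
move=> [fr fi]; split.
  by rewrite (_ : (fun x => _) = (fun x => complex.Re (f x)))//;
    apply/funext => x; case: (f x).
rewrite (_ : (fun x => _) = (fun x => - complex.Im (f x))).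
  by apply: measurableT_comp.
by apply/funext => x; case: (f x).
Qed.

Lemma cmeasurable_cst (z : C) : cmeasurable (fun _ : T => z).
Proof. by split; exact: measurable_cst. Qed.

Definition cintegrable f :=
  mu.-integrable setT (fun x => (complex.Re (f x))%:E) /\
  mu.-integrable setT (fun x => (complex.Im (f x))%:E).

(** The real and imaginary parts are dominated by [sqc (f x) + sqc (g x)], as seen by expanding
    squares of sums and differences of the real coordinates. *)
Lemma cintegrable_inner f g : inL2 mu f -> inL2 mu g ->
  cintegrable (fun x => f x * (g x)^*%C).
Proof.
move=> /inL2_energy[mf ff] /inL2_energy[mg fg].
have [mr mi] := cmeasurableM mf (cmeasurable_conj mg).
have int_e h : cmeasurable h -> (energy h < +oo)%E ->
    mu.-integrable setT (fun x => (sqc (h x))%:E).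
  move=> mh fh; apply/integrableP; split; first exact: measurable_energy.
  by under eq_integral do rewrite gee0_abs ?lee_fin ?sqc_ge0//.
have bound : mu.-integrable setT (fun x => (sqc (f x))%:E + (sqc (g x))%:E)%E.
  exact: integrableD (int_e _ mf ff) (int_e _ mg fg).
have leB x : `|complex.Re (f x * (g x)^*%C)| <= sqc (f x) + sqc (g x) /\
             `|complex.Im (f x * (g x)^*%C)| <= sqc (f x) + sqc (g x).
  case: (f x) => a b; case: (g x) => c e; rewrite /sqc /= !ler_norml.
  have := sqr_ge0 (a - c); have := sqr_ge0 (a + c); have := sqr_ge0 (b - e).
  have := sqr_ge0 (b + e); have := sqr_ge0 (a - e); have := sqr_ge0 (a + e).
  have := sqr_ge0 (b - c); have := sqr_ge0 (b + c).
  have := sqr_ge0 a; have := sqr_ge0 b; have := sqr_ge0 c; have := sqr_ge0 e.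
  by rewrite !expr2 => *; split; apply/andP; split; lra.
have gb x : (`|(sqc (f x))%:E + (sqc (g x))%:E| = (sqc (f x) + sqc (g x))%:E)%E.
  by rewrite -EFinD gee0_abs// lee_fin addr_ge0// sqc_ge0.
split; apply: (le_integrable measurableT _ _ bound); try exact/measurable_EFinP;
  by move=> x _; rewrite gb lee_fin; have [] := leB x.
Qed.

Lemma cintegral_conj f : cintegrable f ->
  cintegral mu (fun x => (f x)^*%C) = (cintegral mu f)^*%C.
Proof.
move=> [ir ii]; rewrite /cintegral /=; congr (_ +i* _)%C.
  by congr fine; apply: eq_integral => x _; case: (f x).
rewrite -mulN1r -RintegralZl//; congr fine; apply: eq_integral => x _.
by rewrite mulN1r; case: (f x).
Qed.

Lemma cintegralZ (k : R) f : cintegrable f ->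
  cintegral mu (fun x => k%:C%C * f x) = k%:C%C * cintegral mu f.
Proof.
move=> [ir ii].
have E a b : k%:C%C * (a +i* b)%C = (k * a +i* (k * b))%C :> C.
  by apply/eqP; rewrite eq_complex /= !mul0r subr0 addr0 !eqxx.
rewrite /cintegral E -!RintegralZl//.
by congr (_ +i* _)%C; congr fine; apply: eq_integral => x _; case: (f x) => a b; rewrite E.
Qed.

Lemma innerL2_energy0 f g : cmeasurable f -> cmeasurable g -> energy g = 0%E ->
  innerL2 mu f g = 0.
Proof.
move=> mf mg eg.
have ae0 : {ae mu, forall x, g x = 0}.
  have /(ae_eq_integral_abs mu measurableT (measurable_energy mg)) :
      (\int[mu]_x `|(sqc (g x))%:E| = 0)%E.
    by under eq_integral do rewrite gee0_abs ?lee_fin ?sqc_ge0//.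
  by apply: filterS => x /(_ I) /= [] /sqc_eq0.
have [mr mi] := cmeasurableM mf (cmeasurable_conj mg).
have I0 (p : C -> R) : p 0 = 0 ->
    measurable_fun setT (fun x => p (f x * (g x)^*%C)) ->
    Rintegral mu setT (fun x => p (f x * (g x)^*%C)) = 0.
  move=> p0 mp; rewrite /Rintegral (ae_eq_integral (cst 0%E)) ?integral0//.
    exact/measurable_EFinP.
  by move: ae0; apply: filterS => x /= -> _; rewrite conjc0 mulr0 p0.
by rewrite /innerL2 /cintegral !I0.
Qed.

End Measure.
End Energy.

(** * The quasi-regular representation and its behaviour under dilation *)

Section QuasiRegular.
Variables (R : realType) (n : nat).
Local Notation C := R[i].
Local Notation lam := (@lebesgue_cV R n).
Implicit Types (f psi : 'cV[R]_n -> C) (A : 'M[R]_n) (b : 'cV[R]_n).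

Lemma cmeasurable_affine f A b : cmeasurable (f : borel 'cV[R]_n -> C) ->
  cmeasurable (fun y : borel 'cV[R]_n => f (A *m y + b)).
Proof.
move=> [mr mi]; split.
  exact: (measurable_fun_comp mr (measurable_affine A b)).
exact: (measurable_fun_comp mi (measurable_affine A b)).
Qed.

Lemma energy_affine f A b : A \in unitmx -> cmeasurable (f : borel 'cV[R]_n -> C) ->
  (energy lam (fun y => f (A *m y + b)%R) = (`|\det A|^-1)%:E * energy lam f)%E.
Proof.
move=> uA mf; rewrite /energy.
rewrite -(@integral_affine R n A b (fun y => (sqc (f y))%:E))//.
  exact: measurable_energy.
by move=> y; rewrite lee_fin sqc_ge0.
Qed.

(** The substitution rule for nonnegative functions is applied to the positive and negative parts,
    whose integrals are finite and may be subtracted. *)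
Lemma Rintegral_affine A b (f : borel 'cV[R]_n -> R) : A \in unitmx ->
  lam.-integrable setT (EFin \o f) ->
  Rintegral lam setT (fun y => f (A *m y + b)) =
  `|\det A|^-1 * Rintegral lam setT f.
Proof.
move=> uA intf; have mf := measurable_int _ intf.
rewrite /Rintegral integralE [in RHS]integralE.
have fP := integrable_pos_fin_num measurableT intf.
have fN := integrable_neg_fin_num measurableT intf.
have -> : (\int[lam]_y (fun y => (f (A *m y + b)%R)%:E)^\+ y =
    (`|\det A|^-1)%:E * \int[lam]_y (EFin \o f)^\+ y)%E.
  rewrite -(@integral_affine R n A b (EFin \o f)^\+%E)//; last exact: measurable_funepos.
  by apply: eq_integral => y _; rewrite !funeposE.
have -> : (\int[lam]_y (fun y => (f (A *m y + b)%R)%:E)^\- y =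
    (`|\det A|^-1)%:E * \int[lam]_y (EFin \o f)^\- y)%E.
  rewrite -(@integral_affine R n A b (EFin \o f)^\-%E)//; last exact: measurable_funeneg.
  by apply: eq_integral => y _; rewrite !funenegE.
move: fP fN; set P := (X in X \is a fin_num -> _) => fP.
set N := (X in X \is a fin_num -> _) => fN.
rewrite -[RHS]/(`|\det A|^-1 * fine (P - N)%E) -[LHS]/(fine ((`|\det A|^-1)%:E * P -
  (`|\det A|^-1)%:E * N)%E).
rewrite -(fineK fP) -(fineK fN) -!EFinM -!EFinB /=.
by rewrite -mulrBr.
Qed.

Lemma cintegral_affine A b (F : borel 'cV[R]_n -> C) : A \in unitmx ->
  cintegrable lam F ->
  cintegral lam (fun y => F (A *m y + b)) = (`|\det A|^-1)%:C%C * cintegral lam F.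
Proof.
move=> uA [ir ii].
rewrite /cintegral (Rintegral_affine b uA ir) (Rintegral_affine b uA ii).
by apply/eqP; rewrite eq_complex /= !mul0r subr0 addr0 !eqxx.
Qed.

Lemma e2piN_conj (t : R) : \val (e2pi (- t)) = (\val (e2pi t))^*%C.
Proof. by rewrite /= mulrN cosN sinN. Qed.

Lemma e2piD_val (s t : R) : \val (e2pi (s + t)) = \val (e2pi s) * \val (e2pi t).
Proof. by rewrite e2piD. Qed.

Lemma circle_mulconj (z : circle R) : \val z * (\val z)^*%C = 1.
Proof. by rewrite -sqr_normc circle_norm expr1n. Qed.

Lemma circle_val_inv (z : circle R) : \val (z^-1)%g = (\val z)^*%C.
Proof. by apply: (mulfI (circle_neq0 z)); rewrite circle_mulconj /= divff// circle_neq0. Qed.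

Lemma quasi_regularE (g : aWH R n) psi y : quasi_regular g psi y =
  \val (aWH_z g) * (\val (e2pi (dotv (y - aWH_x g) (aWH_xi g))) *
  (((Num.sqrt `|\det (\val (aWH_h g))|)^-1)%:C%C *
    psi (invmx (\val (aWH_h g)) *m (y - aWH_x g)))).
Proof. by []. Qed.

Lemma GL_det_gt0 (h : GL R n) : 0 < `|\det (\val h)|.
Proof. by rewrite normr_gt0 -unitfE -unitmxE (valP h). Qed.

Lemma cmeasurable_quasi_regular (g : aWH R n) psi :
  cmeasurable (psi : borel 'cV[R]_n -> C) ->
  cmeasurable (quasi_regular g psi : borel 'cV[R]_n -> C).
Proof.
move=> mpsi; apply: cmeasurableM; first exact: cmeasurable_cst.
rewrite /translation /modulation; apply: cmeasurableM.
  have c : continuous (fun y : 'cV[R]_n => e2pi (dotv (y - aWH_x g) (aWH_xi g))).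
    apply: (continuous_comp_fun _ (@e2pi_continuous R)).
    apply: continuous_dotv; last exact: cst_continuous.
    apply: continuous_addmx; last exact: cst_continuous.
    by move=> x; exact: cvg_id.
  split.
    exact: (@measurable_continuous_real R 'cV[R]_n _ (continuous_comp_fun c (@circle_re_continuous R))).
  exact: (@measurable_continuous_real R 'cV[R]_n _ (continuous_comp_fun c (@circle_im_continuous R))).
apply: cmeasurableM; first exact: cmeasurable_cst.
have := @cmeasurable_affine psi (invmx (\val (aWH_h g)))
  (- (invmx (\val (aWH_h g)) *m aWH_x g)) mpsi.
by under eq_fun do rewrite -mulmxBr.
Qed.

Lemma energy_quasi_regular (g : aWH R n) psi :
  cmeasurable (psi : borel 'cV[R]_n -> C) ->
  energy lam (quasi_regular g psi) = energy lam psi.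
Proof.
move=> mpsi; set h := \val (aWH_h g).
have uh : invmx h \in unitmx by rewrite unitmx_inv (valP (aWH_h g)).
have h0 : 0 < `|\det h| := GL_det_gt0 (aWH_h g).
pose b := - (invmx h *m aWH_x g).
transitivity (\int[lam]_y ((`|\det h|^-1)%:E * (sqc (psi (invmx h *m y + b)%R))%:E))%E.
  apply: eq_integral => y _; rewrite quasi_regularE -/h !sqcM !sqc_circle !mul1r.
  by rewrite sqc_real exprVn sqr_sqrtr ?normr_ge0// mulmxBr.
have ms := measurable_energy (cmeasurable_affine (invmx h) b mpsi).
have sge0 (y : borel 'cV[R]_n) : (0 <= (sqc (psi (invmx h *m y + b)%R))%:E)%E.
  by rewrite lee_fin sqc_ge0.
have ih0 : 0 <= `|\det h|^-1 by rewrite invr_ge0.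
rewrite ge0_integralZl_EFin//.
rewrite -/(energy _ _) energy_affine// det_inv normfV invrK muleA -EFinM.
by rewrite mulVf ?mul1e// gt_eqF.
Qed.

Lemma inL2_quasi_regular (g : aWH R n) psi :
  inL2 lam psi -> inL2 lam (quasi_regular g psi).
Proof.
move=> /inL2_energy[mpsi ?]; apply/inL2_energy; split.
  exact: cmeasurable_quasi_regular.
by rewrite energy_quasi_regular.
Qed.

Definition scaled (a : R) psi : 'cV[R]_n -> C := fun y => psi (a *: y).

Lemma scaledE a psi : scaled a psi = (fun y => psi (a%:M *m y + 0)).
Proof. by apply/funext => y; rewrite addr0 mul_scalar_mx. Qed.

Lemma energy_scaled a psi : 0 < a -> cmeasurable (psi : borel 'cV[R]_n -> C) ->
  (energy lam (scaled a psi) = (a ^+ n)^-1%:E * energy lam psi)%E.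
Proof.
move=> a0 mpsi; rewrite scaledE energy_affine// ?det_scalar.
  by rewrite normrX (ger0_norm (ltW a0)).
by rewrite unitmxE det_scalar unitfE expf_neq0// gt_eqF.
Qed.

Lemma cmeasurable_scaled a psi : cmeasurable (psi : borel 'cV[R]_n -> C) ->
  cmeasurable (scaled a psi : borel 'cV[R]_n -> C).
Proof. by move=> mpsi; rewrite scaledE; exact: cmeasurable_affine. Qed.

Lemma inL2_scaled a psi : 0 < a -> inL2 lam psi -> inL2 lam (scaled a psi).
Proof.
move=> a0 /inL2_energy[mpsi fpsi]; apply/inL2_energy; split.
  exact: cmeasurable_scaled.
by rewrite energy_scaled// lte_mul_pinfty// lee_fin invr_ge0 exprn_ge0// ltW.
Qed.

Lemma cintegrable_conj (F : borel 'cV[R]_n -> C) :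
  cintegrable lam F -> cintegrable lam (fun y => (F y)^*%C).
Proof.
move=> [ir ii]; split.
  by move: ir; congr (lam.-integrable _ _); apply/funext => y; case: (F y).
rewrite (_ : (fun y => _) = (fun y => - (complex.Im (F y))%:E)%E).
  exact: integrableN.
by apply/funext => y; case: (F y).
Qed.

Lemma cintegrableZ (k : R) (F : borel 'cV[R]_n -> C) :
  cintegrable lam F -> cintegrable lam (fun y => k%:C%C * F y).
Proof.
move=> [ir ii]; split.
  rewrite (_ : (fun y => _) = (fun y => k%:E * (complex.Re (F y))%:E)%E).
    exact: integrableZl.
  by apply/funext => y; case: (F y) => a b; rewrite /= mul0r subr0.
rewrite (_ : (fun y => _) = (fun y => k%:E * (complex.Im (F y))%:E)%E).
  exact: integrableZl.
by apply/funext => y; case: (F y) => a b; rewrite /= mul0r addr0.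
Qed.

Variable G : tcSubgroup R n.

(* Both sides are integrals of [psi] against a transform of itself; the affine
   substitution [y = h^-1 (a v - x)] exchanges the two factors. *)
Lemma wavelet_inv_dilate psi (a : R) (g : tcType G) : 0 < a -> inL2 lam psi ->
  wavelet_transform psi (scaled a psi) (dilate a g) =
  ((a ^+ n)^-1)%:C%C * (wavelet_transform psi (scaled a^-1 psi) (g^-1)%g)^*%C.
Proof.
move=> a0 Lpsi.
have an0 : a != 0 by rewrite gt_eqF.
pose I2 y := scaled a^-1 psi y * (quasi_regular (\val (g^-1)%g) psi y)^*%C.
have cI2 : cintegrable lam I2.
  apply: cintegrable_inner; last exact: inL2_quasi_regular.
  by apply: inL2_scaled => //; rewrite invr_gt0.
have [ez ex exi eh] := tc_invE g; have [dz dx dxi dh] := dilateE a g.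
pose z := aWH_z (\val g); pose x := aWH_x (\val g); pose xi := aWH_xi (\val g).
pose h := \val (aWH_h (\val g)).
have uh : h \in unitmx := valP (aWH_h (\val g)).
have h0 : 0 < `|\det h| := GL_det_gt0 (aWH_h (\val g)).
have s0 : Num.sqrt `|\det h| != 0 by rewrite sqrtr_eq0 -ltNge.
pose B := a *: invmx h; pose b := - (invmx h *m x).
have dB : `|\det B|^-1 = (a ^+ n)^-1 * `|\det h|.
  rewrite /B detZ det_inv normrM normfV normrX (ger0_norm (ltW a0)).
  by rewrite invfM invrK.
have uB : B \in unitmx.
  by rewrite unitmxE detZ unitfE mulf_neq0 ?expf_neq0// -unitfE -unitmxE unitmx_inv.
transitivity (cintegral lam (fun v => (`|\det h|^-1)%:C%C * (I2 (B *m v + b))^*%C)).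
  congr cintegral; apply/funext => v.
  rewrite /I2 /scaled !quasi_regularE ez ex exi eh dz dx dxi dh.
  rewrite -/z -/x -/xi -/h.
  have -> : \val ((aWH_h (\val g))^-1)%g = invmx h by [].
  have Ev : B *m v + b + invmx h *m x = invmx h *m (a *: v).
    by rewrite subrK /B -scalemxAl scalemxAr.
  rewrite opprK Ev mulmxA invmxK mulmxV// mul1mx.
  rewrite det_inv normfV sqrtrV// invrK.
  have -> : a^-1 *: (B *m v + b) = invmx h *m (v - a^-1 *: x).
    rewrite /B /b scalerDr -scalemxAl scalerA mulVf// scale1r scalerN mulmxBr.
    by rewrite scalemxAr.
  have -> : dotv (v - a^-1 *: x) (a *: xi) = dotv (a *: v) xi - dotv x xi.
    by rewrite dotvZr dotvDl dotvNl !dotvZl mulrBr mulrA mulfV// mul1r.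
  have -> : dotv (invmx h *m (a *: v)) (- (h^T *m xi)) = - dotv (a *: v) xi.
    by rewrite dotvNr -dotvM mulmxA mulmxV// mul1mx.
  have -> : dotv xi x = dotv x xi by apply: eq_bigr => i _; rewrite mulrC.
  (* The normalizing factors of the dilations by [h] on the left and by its inverse on the right
     differ by [|det h|]; the Jacobian of the substitution cancels this discrepancy. *)
  have key : ((Num.sqrt `|\det h|)^-1)%:C%C =
      (`|\det h|^-1)%:C%C * (Num.sqrt `|\det h|)%:C%C :> C.
    rewrite -rmorphM /=; congr (_%:C)%C; rewrite -[X in X^-1 * _]sqr_sqrtr ?ltW//.
    by rewrite expr2 invfM mulfVK.
  have cM (u w : C) : conjc (u * w) = conjc u * conjc w by exact: rmorphM.
  have -> : \val (z^-1 * e2pi (dotv x xi))%g = \val (z^-1)%g * \val (e2pi (dotv x xi)) by [].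
  rewrite e2piD_val !e2piN_conj circle_val_inv !(cM, conjcK, conjc_real) key.
  by ring.
rewrite (cintegral_affine b (F := fun y => (`|\det h|^-1)%:C%C * (I2 y)^*%C))//; last first.
  exact: cintegrableZ (cintegrable_conj cI2).
rewrite cintegralZ ?cintegral_conj//; last exact: cintegrable_conj.
by rewrite mulrA -rmorphM /= dB -mulrA mulfV ?gt_eqF// mulr1.
Qed.

End QuasiRegular.

(** * Consequences of admissibility for energies *)

Section Admissible.
Variables (R : realType) (n : nat) (G : tcSubgroup R n).
Local Notation T := (tcType G).
Local Notation lam := (@lebesgue_cV R n).
Local Notation C := R[i].

Lemma inL2_0 : inL2 lam (fun=> 0).
Proof.
apply/inL2_energy; split; first exact: cmeasurable_cst.
by rewrite /energy; under eq_integral do rewrite sqc0; rewrite integral0 ltry.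
Qed.

(** The function [F] is a measurable representative of the squared transform, and [K] is the squared
    modulus of [c]. As [U] is only given to preserve distances, [U f] is replaced by its difference
    with the image of zero, which vanishes almost everywhere because the transform of zero is
    zero. *)
Lemma admissible_energy (mu : {measure set (borel T) -> \bar R}) psi :
  inL2 lam psi -> admissible_vector mu psi ->
  exists2 K : R, 0 < K & forall f, inL2 lam f -> exists F : borel T -> \bar R,
    [/\ measurable_fun setT F, forall g, (0 <= F g)%E,
      {ae mu, forall g, F g = (sqc (wavelet_transform psi f g))%:E} &
      (\int[mu]_g F g = K%:E * energy lam f)%E].
Proof.
move=> Lpsi [c [c0 [U [[UL2 Uiso] aeU]]]].
have K0 : 0 < sqc c.
  rewrite lt_neqAle sqc_ge0 andbT eq_sym; apply: contra_neq c0; exact: sqc_eq0.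
exists (sqc c) => // f Lf.
have [mUf _] := UL2 _ Lf; have [mU0 _] := UL2 _ inL2_0.
have mB := cmeasurableB mUf mU0.
have sge0 g : (0 <= (sqc (U f g - U (fun=> 0%R) g))%:E)%E by rewrite lee_fin sqc_ge0.
exists (fun g => (sqc c)%:E * (sqc (U f g - U (fun=> 0%R) g))%:E)%E; split.
- by apply: emeasurable_funM => //; exact: measurable_energy.
- by move=> g; rewrite mule_ge0// lee_fin sqc_ge0.
- have := aeU _ inL2_0; have := aeU _ Lf; apply: filterS2 => g -> V0.
  have : c * U (fun=> 0) g = 0.
    rewrite -V0 /wavelet_transform /innerL2.
    under eq_fun do rewrite mul0r.
    by rewrite /cintegral /Rintegral /= integral0.
  by move=> /eqP; rewrite mulf_eq0 (negbTE c0) /= => /eqP ->; rewrite subr0 -EFinM sqcM.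
- rewrite ge0_integralZl_EFin//; last 2 first.
    exact: measurable_energy.
    exact: ltW.
  congr (_ * _)%E.
  have := Uiso _ _ Lf inL2_0 => /(congr1 (fun x => x `^ 2)%E).
  rewrite !energyE => E; apply: etrans E _; apply: eq_integral => y _.
  by rewrite subr0.
Qed.

(** If psi vanished almost everywhere, so would the transform of every function, whereas the
    transform of a cube indicator has energy [K * 2 ^+ n], which is positive. *)
Lemma admissible_energy_neq0 (mu : {measure set (borel T) -> \bar R}) psi :
  inL2 lam psi -> admissible_vector mu psi -> energy lam psi != 0%E.
Proof.
move=> Lpsi /(admissible_energy Lpsi)[K K0 HK]; apply/eqP => E0.
have [mpsi _] := (inL2_energy _ _).1 Lpsi.
pose f : 'cV[R]_n -> C := fun y => (\1_(cube 1) y)%:C%C.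
have mf : cmeasurable (f : borel 'cV[R]_n -> C).
  split; last exact: measurable_cst.
  by apply: measurable_indic; exact: measurable_cube.
have ef : energy lam f = (2 ^+ n)%:E.
  transitivity (\int[lam]_y (\1_(cube 1) y)%:E)%E.
    apply: eq_integral => y _; rewrite sqc_real indicE.
    by case: (y \in _); rewrite /= ?expr1n ?expr0n.
  rewrite integral_indic ?setIT//; last exact: measurable_cube.
  by apply: etrans (lebesgue_cV_cube n ler01) _; rewrite mulr1.
have Lf : inL2 lam f by apply/inL2_energy; split=> //; rewrite ef ltry.
have [F [mF F0 aeF]] := HK _ Lf.
rewrite (ge0_ae_eq_integral (g := cst 0%E))//; last first.
  move: aeF; apply: filterS => g -> _ /=.
  rewrite /wavelet_transform innerL2_energy0 ?sqc0//.
    exact: cmeasurable_quasi_regular.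
  by rewrite energy_quasi_regular.
rewrite integral0 ef -EFinM => -[] /esym/eqP.
by rewrite mulf_eq0 gt_eqF//= expf_eq0 pnatr_eq0 andbF.
Qed.

End Admissible.

(** Carries almost everywhere statements along dilation and inversion: the measurable
    representatives of the squared transforms are evaluated at transformed points. *)
Lemma null_preimage d (T : measurableType d) (R : realType)
    (mu : {measure set T -> \bar R}) (phi : T -> T) (k : R) (N : set T) :
  measurable_fun setT phi ->
  (forall F : T -> \bar R, measurable_fun setT F -> (forall x, (0 <= F x)%E) ->
    (\int[mu]_x F (phi x) = k%:E * \int[mu]_x F x)%E) ->
  mu.-negligible N -> mu.-negligible (phi @^-1` N).
Proof.
move=> mphi H [A [mA A0 NA]].
have mpA : measurable (phi @^-1` A).
  by rewrite -[X in measurable X]setTI; exact: mphi.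
exists (phi @^-1` A); split=> [//||x /= /NA//].
have mA1 : measurable_fun setT (fun x => (\1_A x)%:E : \bar R).
  by apply/measurable_EFinP; exact: measurable_indic.
have -> : mu (phi @^-1` A) = (\int[mu]_x (\1_(phi @^-1` A) x)%:E)%E.
  by rewrite integral_indic// setIT.
apply: etrans (H (fun x => (\1_A x)%:E) mA1 _) _ => [x|]; first by rewrite lee_fin.
by rewrite integral_indic// setIT A0 mule0.
Qed.

Section SigmaFiniteCopy.
Context d (T : measurableType d) (R : realType) (mu : {measure set T -> \bar R}).
Hypothesis mu_sf : sigma_finite setT mu.

(* The unused argument lets the instance below carry its own proof. *)
Definition sigma_finite_copy of sigma_finite setT mu : set T -> \bar R := mu.

HB.instance Definition _ := Measure.copy (sigma_finite_copy mu_sf) mu.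
HB.instance Definition _ :=
  Measure_isSigmaFinite.Build _ _ _ (sigma_finite_copy mu_sf) mu_sf.

End SigmaFiniteCopy.

Theorem corollary4p11 (R : realType) (n : nat) (G : tcSubgroup R n)
    (mu : {measure set (borel (tcType G)) -> \bar R}) :
  left_haar mu ->
  unimodular R (tcType G) ->
  tcV G != fullv ->
  ~ admissible mu.
Proof.
move=> haar uni Vproper [psi Lpsi adm].
have [_ mu0 li] := haar; have ri := uni mu haar.
pose m : {sigma_finite_measure set (borel (tcType G)) -> \bar R} :=
  sigma_finite_copy (haar_sigma_finite haar).
have pl : forall h, preserves m (fun g : borel (tcType G) => (h * g)%g).
  exact: (left_invariant_preserves li).
have pr : forall h, preserves m (fun g : borel (tcType G) => (g * h)%g).
  exact: (right_invariant_preserves ri).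
have p20 : 0 < 2 :> R by [].
have int_dilate (F : borel (tcType G) -> \bar R) : measurable_fun setT F -> (forall g, (0 <= F g)%E) ->
    (\int[mu]_g F (dilate 2 g) = (2 ^+ n / 2 ^+ \dim (tcV G))%:E * \int[mu]_g F g)%E.
  exact: (@integral_dilate R n G m mu0 pl pr 2 F p20).
have int_inv (F : borel (tcType G) -> \bar R) : measurable_fun setT F -> (forall g, (0 <= F g)%E) ->
    (\int[mu]_g F (g^-1)%g = \int[mu]_g F g)%E.
  exact: (@integral_tc_inv R n G m mu0 pl pr F).
have E0 := admissible_energy_neq0 Lpsi adm.
have [mpsi Efin] := (inL2_energy _ _).1 Lpsi.
have [K K0 HK] := admissible_energy Lpsi adm.
have p20' : 0 < 2^-1 :> R by rewrite invr_gt0.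
have [F1 [mF1 F10 aeF1 intF1]] := HK _ (inL2_scaled p20 Lpsi).
have [F2 [mF2 F20 aeF2 intF2]] := HK _ (inL2_scaled p20' Lpsi).
have mdil := @measurable_dilate R n G 2.
have minv := @measurable_tc_inv R n G.
have k4 : 0 <= ((2 ^+ n)^-1) ^+ 2 :> R by rewrite exprn_ge0// invr_ge0 exprn_ge0.
(* The transforms are related at every point, but [F1] and [F2] agree with their squared moduli only
   off null sets, which are pulled back by dilation and by inversion. *)
have key : (\int[mu]_g F1 (dilate 2 g) =
    \int[mu]_g ((((2 ^+ n)^-1) ^+ 2)%:E * F2 (g^-1)%g))%E.
  apply: ge0_ae_eq_integral => //.
  - exact: (measurable_fun_comp mF1 mdil).
  - by apply: emeasurable_funM => //; exact: (measurable_fun_comp mF2 minv).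
  - by move=> g _; rewrite mule_ge0.
  have ae1 := null_preimage mdil int_dilate aeF1.
  have ae2 : mu.-negligible ((fun g => g^-1)%g @^-1` ~` [set g | F2 g =
      (sqc (wavelet_transform psi (scaled 2^-1 psi) g))%:E]).
    apply: (null_preimage (k := 1) minv _ aeF2) => F mF F0.
    by rewrite mul1e int_inv.
  have := negligibleU ae1 ae2; apply: negligibleS => g /= nH.
  apply: contrapT => /not_orP[/contrapT /= H1 /contrapT /= H2]; apply: nH => _.
  rewrite H1 H2 wavelet_inv_dilate// sqcM sqc_conj sqc_real -EFinM.
  by [].
move: key; rewrite int_dilate// ge0_integralZl_EFin//; last first.
  exact: (measurable_fun_comp mF2 minv).
rewrite int_inv// intF1 intF2 !energy_scaled//.
have fE : energy (@lebesgue_cV R n) psi \is a fin_num by rewrite ge0_fin_numE// energy_ge0.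
rewrite -(fineK fE) -!EFinM => -[] /eqP.
have e0 : fine (energy (@lebesgue_cV R n) psi) != 0 by rewrite fine_eq0.
have dn := dimv_lt Vproper.
rewrite (exprVn 2 n) invrK => /eqP.
set e := fine _ in e0 *; set p : R := 2 ^+ n; set q : R := 2 ^+ _ => eq_pq.
have p0 : p != 0 by rewrite expf_neq0.
have q0 : q != 0 by rewrite expf_neq0.
(* In [eq_pq] the left side is [K * e / q] and the right side is [K * e / p]; multiplying by [p * q]
   clears the denominators, and [p = q] contradicts the strict inequality of dimensions. *)
have : (K * e) * p = (K * e) * q.
  have -> : K * e * p = p / q * (K * (p^-1 * e)) * (p * q) by field; rewrite p0.
  by rewrite eq_pq; field.
move/(mulfI (mulf_neq0 (lt0r_neq0 K0) e0))/eqP.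
by rewrite eq_le /p /q !ler_eXn2l ?ltr1n// [(n <= _)%N]leqNgt dn.
Qed.
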